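(* Let $\lambda,\mu$ be two partitions with $|\lambda|=|\mu|$. Suppose that the sum of the number of odd integers that appear an odd number of times in $\lambda$ and the number of odd integers that appear an odd number of times in $\mu$ is at most $2$. Put $z_{\lambda,\mu}(g,m)=Z_g((\lambda,1^{2m}),(\mu,1^{2m});\Lambda_{0,t})$ with $t=l(\lambda)+l(\mu)+2g-2+4m$. Then the uniform logarithmic asymptotics for the zigzag numbers $z_{\lambda,\mu}(g,m)$ is at least $2g\ln m+4m\ln m$ as $m,g\to\infty$, that is, $$\liminf_{g,m\to\infty}\frac{\ln z_{\lambda,\mu}(g,m)}{2g\ln m+4m\ln m}\geq 1.$$
   Context: **Conventions.** Partitions are unordered; $l(\lambda)$ is the number of entries and $|\lambda|$ the sum of the entries of $\lambda$; $(1^n)$ is the partition with $n$ entries equal to $1$; $(\lambda,\nu)$ is the partition whose entries are those of $\lambda$ together with those of $\nu$. The liminf over $g,m\to\infty$ is joint: $\liminf f\ge1$ means that for every $\varepsilon>0$ there is $N$ with $f(g,m)\ge1-\varepsilon$ whenever $g,m\ge N$. **Tropical covers.** A tropical curve $C$ is a connected metric graph all of whose vertices have valence $1$ (leaves) or $3$ (inner vertices); edges incident to leaves are called ends and have infinite length, all other edges are inner edges and have finite length. The genus of $C$ is its first Betti number. An isomorphism of tropical curves is an isometric homeomorphism of the curves with leaves removed. Put $T\mathbb{P}^1=\mathbb{R}\cup\{\pm\infty\}$. Let $g\ge0$, let $\lambda,\mu$ be partitions with $|\lambda|=|\mu|\ge1$, let $t=l(\lambda)+l(\mu)+2g-2$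 and let $\underline y=\{y_1<\dots<y_t\}\subset\mathbb{R}$; it is assumed throughout that $t>0$ and that $\{\lambda,\mu\}\not\subset\{(2k),(k,k)\}$ for all $k$. A tropical cover of type $(g,\lambda,\mu,\underline y)$ is a continuous map $\varphi:C\to T\mathbb{P}^1$ from a tropical curve of genus $g$ such that: the set of images of the inner vertices is $\underline y$ (so $\varphi$ is a bijection from inner vertices to $\underline y$); leaves are mapped to $\{\pm\infty\}$; $\varphi$ is piecewise integer affine linear with slope $\omega(e)\in\mathbb{N}_{>0}$ (the weight) on each edge $e$; at each inner vertex, orienting edges in the direction in which $\varphi$ increases, the sum of the weights of incoming edges equals that of outgoing edges; the entries of $\lambda$ (resp. $\mu$) are the weights of the ends going to $-\infty$ (resp. $+\infty$). Edges are called odd/even according to their weights. Covers $\varphi_1,\varphi_2$ are isomorphic if there is an isomorphism $\Phi:C_1\to C_2$ of tropical curves with $\varphi_2\circ\Phi=\varphi_1$. **Zigzag numbers $Z_g(\lambda,\mu;\Lambda_{0,t})$ (no triple points).** A symmetric cycle (resp. symmetric fork) is a pair of inner edges of equal weight with the same two endpoints (resp. a pair of ends of equal weight adjacent to the same inner vertex). A tropical cover $\varphi:C\to T\mathbb{P}^1$ of type $(g,\lambda,\mu,\underline y)$ is a generalized zigzag cover if there is a non-empty connected subgraph $S\subset C$ containing at least one inner vertex, containing no even edge and no edge of a symmetric cycle or symmetric fork, such that every connected component of $C\setminus S$ is a tail of one of the following forms, attached to $S$ at one point, with $o$ odd and $e$ even: a symmetric fork of two ends of weight $o$ followed by a chain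 of $n\ge0$ symmetric cycles with edges of weight $o$, consecutive pieces and finally $S$ being connected by edges of weight $2o$; one end of weight $2o$ followed by a chain of $n\ge0$ symmetric cycles with edges of weight $o$, consecutive pieces and finally $S$ being connected by edges of weight $2o$; a symmetric fork of two ends of weight $e$ connected to $S$ by an edge of weight $2e$; a single end of weight $2e$ attached to $S$. $\Lambda_{0,t}$ is the $t$-tuple all of whose entries are the partition $(2,1,\dots,1)$ of $|\lambda|$, and $Z_g(\lambda,\mu;\Lambda_{0,t})$ is the number of isomorphism classes of generalized zigzag covers of type $(g,\lambda,\mu,\underline y)$; it does not depend on $\underline y$. (In the paper's general definition each class is weighted by $2^{m(\varphi)}$ with $m(\varphi)\in\{0,1\}$ recording the parity of a real multiplicity; when there are no triple points all these multiplicities are odd and $m(\varphi)=0$.) *)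

(* Defs.v *)
From HB Require Import structures.
From mathcomp Require Import all_boot all_order all_algebra.
From mathcomp Require Import all_classical all_reals all_analysis.

Set Implicit Arguments.
Unset Strict Implicit.
Unset Printing Implicit Defensive.

Import Order.TTheory GRing.Theory Num.Theory.

Local Open Scope classical_set_scope.
Local Open Scope ring_scope.

(** A partition is the sequence of its entries; all definitions below depend on
    it only up to [perm_eq]. *)
Definition is_partition (la : seq nat) : bool := all (leq 1) la.

Definition odd_mult_odds (la : seq nat) : nat :=
  size [seq k <- undup la | odd k && odd (count_mem k la)].

(** * Metric graphs and tropical curves *)

(** Loops and multiple edges are allowed.  The direction of an edge only names
    its two endpoints: it is not part of the curve (see [curve_iso]). *)
Record metric_graph (R : realType) := MetricGraph {
  vert : finType;
  edge : finType;
  src : edge -> vert;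
  tgt : edge -> vert;
  len : edge -> \bar R
}.

Section TropicalCurve.
Variables (R : realType) (C : metric_graph R).

Definition valence (v : vert C) : nat :=
  (#|[pred e : edge C | src e == v]| + #|[pred e : edge C | tgt e == v]|)%N.

Definition is_leaf (v : vert C) : bool := valence v == 1%N.
Definition is_inner (v : vert C) : bool := valence v == 3%N.

Definition is_end (e : edge C) : bool := is_leaf (src e) || is_leaf (tgt e).

Definition joins (e : edge C) (u v : vert C) : bool :=
  ((src e == u) && (tgt e == v)) || ((src e == v) && (tgt e == u)).

(** The graph as a disjoint union of its vertices and its open edges, so that
    a union of cells such as the complement of a subgraph is a [{set cell}]. *)
Definition cell : finType := (vert C + edge C)%type.

Definition incident (x y : cell) : bool :=
  match x, y with
  | inl v, inr e | inr e, inl v => (src e == v) || (tgt e == v)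
  | _, _ => false
  end.

Definition adj_in (A : {set cell}) : rel cell :=
  fun x y => [&& x \in A, y \in A & incident x y].

Definition connected_cells (A : {set cell}) : Prop :=
  A != finset.set0 /\ {in A &, forall x y, connect (adj_in A) x y}.

Definition component (A : {set cell}) (x : cell) : {set cell} :=
  [set y in A | connect (adj_in A) x y].

Definition subgraph (S : {set cell}) : Prop :=
  forall e, inr e \in S -> (inl (src e) \in S) && (inl (tgt e) \in S).

(** [#|E| - #|V| + b_0]; the truncated subtraction is harmless, since every
    graph has [#|V| <= #|E| + b_0]. *)
Definition betti1 : nat :=
  (#|edge C| + n_comp (adj_in [set: cell]) cell - #|vert C|)%N.

Definition tropical_curve : Prop :=
  [/\ connected_cells [set: cell],
      forall v, is_leaf v || is_inner v
    & forall e, if is_end e then len e = +oo%E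
                else exists2 l : R, 0 < l & len e = l%:E].

End TropicalCurve.

Definition curve_iso (R : realType) (C D : metric_graph R)
    (fV : vert C -> vert D) (fE : edge C -> edge D) : Prop :=
  [/\ bijective fV, bijective fE,
      forall e, joins (fE e) (fV (src e)) (fV (tgt e))
    & forall e, len (fE e) = len e].

(** * Tropical covers *)

(** The map is recorded by its values at the vertices and its slopes. *)
Record cover_data (R : realType) := CoverData {
  curve :> metric_graph R;
  phi : vert curve -> \bar R;
  wt : edge curve -> nat
}.

Arguments phi {R} _ _.
Arguments wt {R} _ _.

(** The slope equation normalizes the direction of every edge to be the one in
    which the map increases, which is possible because slopes are nonzero.  On
    an end both sides of it are [+oo], which says that the leaf is sent to
    [-oo] if it is the source and to [+oo] if it is the target. *)
Definition tropical_cover (R : realType) (g : nat) (la mu : seq nat)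
    (y : seq R) (c : cover_data R) : Prop :=
  [/\ tropical_curve c /\ betti1 c = g,
      phi c @` [set v | is_inner v] = EFin @` [set r | r \in y] /\
      (forall v : vert c, is_leaf v -> phi c v = -oo%E \/ phi c v = +oo%E),
      forall e : edge c, (0 < wt c e)%N /\
        (phi c (tgt e) - phi c (src e) = (wt c e)%:R%:E * len e)%E,
      forall v : vert c, is_inner v ->
        (\sum_(e : edge c | tgt e == v) wt c e =
         \sum_(e : edge c | src e == v) wt c e)%N
    & perm_eq [seq wt c e | e <- enum (edge c) & phi c (src e) == -oo%E] la /\
      perm_eq [seq wt c e | e <- enum (edge c) & phi c (tgt e) == +oo%E] mu].

(** A map of metric graphs that is affine on edges commutes with the two covers
    iff it does so at the vertices and the slopes agree (the slopes on ends are
    not determined by the other data). *)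
Definition cover_iso (R : realType) (c d : cover_data R) : Prop :=
  exists (fV : vert c -> vert d) (fE : edge c -> edge d),
    [/\ curve_iso fV fE,
        forall v, phi d (fV v) = phi c v
      & forall e, wt d (fE e) = wt c e].

(** * Zigzag covers *)

Section Zigzag.
Variables (R : realType) (c : cover_data R).

Definition symmetric_cycle (d d' : edge c) : Prop :=
  [/\ d != d', ~~ is_end d, ~~ is_end d', wt c d = wt c d'
    & joins d' (src d) (tgt d)].

Definition symmetric_fork (f f' : edge c) : Prop :=
  [/\ f != f', is_end f, is_end f', wt c f = wt c f'
    & exists v l l', [/\ is_inner v, joins f v l & joins f' v l']].

(** [tail k K v]: the cells [K] form a tail attached at the vertex [v] (not in
    [K]) by an edge of weight [2 * k].  For odd [k] this gives the two forms
    with an arbitrary number of cycles of weight [k]; for even [k], where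
    [tail_cycle] does not apply, the two forms without cycles. *)
Inductive tail (k : nat) : {set cell c} -> vert c -> Prop :=
| tail_fork (f f' b : edge c) (u l l' v : vert c) :
    symmetric_fork f f' -> wt c f = k ->
    is_leaf l -> joins f u l -> is_leaf l' -> joins f' u l' ->
    joins b u v -> wt c b = (2 * k)%N ->
    tail k [set inl u; inl l; inl l'; inr f; inr f'; inr b] v
| tail_end (b : edge c) (l v : vert c) :
    is_leaf l -> joins b l v -> wt c b = (2 * k)%N ->
    tail k [set inl l; inr b] v
| tail_cycle (K : {set cell c}) (d d' b : edge c) (u w v : vert c) :
    odd k -> tail k K u ->
    symmetric_cycle d d' -> wt c d = k -> joins d u w -> joins d' u w ->
    joins b w v -> wt c b = (2 * k)%N ->
    tail k (K :|: [set inl u; inl w; inr d; inr d'; inr b]) v.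

Definition zigzag : Prop :=
  exists S : {set cell c},
    [/\ subgraph S /\ connected_cells S,
        exists2 v, is_inner v & inl v \in S,
        forall e, inr e \in S -> odd (wt c e),
        forall e, inr e \in S ->
          forall e', ~ symmetric_cycle e e' /\ ~ symmetric_fork e e'
      & forall x, x \in ~: S ->
          exists k v, inl v \in S /\ tail k (component (~: S) x) v].

End Zigzag.

(** [E] has [n] classes on the objects satisfying [A]: there is a system of [n]
    representatives. *)
Definition has_class_number (T : Type) (A : T -> Prop) (E : T -> T -> Prop)
    (n : nat) : Prop :=
  exists r : 'I_n -> T,
    [/\ forall i, A (r i),
        forall i j, E (r i) (r j) -> i = j
      & forall x, A x -> exists i, E x (r i)].

(** The value would be 0 if there were infinitely many classes. *)
Definition zigzag_number (R : realType) (g : nat) (la mu : seq nat)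
    (y : seq R) : nat :=
  get [set n | has_class_number
                 (fun c => tropical_cover g la mu y c /\ zigzag c)
                 (@cover_iso R) n].

Definition joint_liminf_ge (R : realType) (f : nat -> nat -> R) (l : R) : Prop :=
  forall eps : R, 0 < eps -> exists N : nat,
    forall g m : nat, (N <= g)%N -> (N <= m)%N -> l - eps <= f g m.

(* Main.v *)
Require Import Defs.
From mathcomp Require Import all_boot all_order all_fingroup all_algebra.
From mathcomp Require Import all_classical all_reals all_analysis.
From mathcomp Require Import zify ring lra.
Import Order.TTheory GRing.Theory Num.Theory.
Set Implicit Arguments.
Unset Strict Implicit.
Unset Printing Implicit Defensive.
Local Open Scope ring_scope.

(** Why there are so many zigzag covers.

    Let S be a path whose edges have odd weights, and glue tails onto it.  Orient
    S from one of its ends to the other and let s_j be the weight of its j-th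
    edge, counted negatively where the cover decreases along S.  A tail that
    comes from -oo and is attached by an edge of weight 2k raises s by 2k, a tail
    that goes to +oo lowers it by 2k.  So s stays odd, hence nonzero, and the
    tails can be attached in any order along S; every total order of the inner
    vertices that increases along all edges then gives a zigzag cover
    ([zcover_tropical], [zcover_zigzag]).

    Every even entry of the two partitions is the end of a tail without fork, and
    equal odd entries go in pairs into forks.  At most two odd entries remain, and
    by parity there are none or two of them: they become the ends of S.  If there
    are none, a pair of ones on the left serves instead ([decompose]).

    A bounded number of forks with ends of weight 1 brings s to -1.  All but
    boundedly many of the remaining ones are then used for n = m - O(1) forks on
    the left and n on the right, attached alternately, so that s alternates
    between -1 and 1 and S turns at each of them.  The vertices of the left ones
    can be placed below those of the right ones, and then the order along S puts
    no further constraint on them.  Naming for each inner vertex, in order of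
    height, the tail to which it belongs turns an order into a word; the number
    of cycles in a tail is encoded by the number of occurrences of its name,
    which only has to be even ([word_layout]).  Isomorphisms preserve heights,
    hence fix the inner vertices, and walking along S and then outwards along
    each tail recovers the word from the cover ([iso_lab]).

    It remains to count words.  The orders of the fork vertices and of the
    attachments of the 2n alternating tails are four arbitrary permutations.  The
    2g cycle vertices are distributed among k of the left tails by an arbitrary
    word of length 2g - k (empty if 2g < k), which is completed to a word of
    length 2g in which every letter occurs an even number of times.  So the zigzag
    number is at least n!^4 * k^(2g - k) ([zigzag_number_lower]), where
    n! >= k^(n - k).  With k about m / D for a large constant D the logarithm of
    this is at least (4m + 2g - 5k - O(1)) ln k, which gives the limit
    ([log_asymptotics]).

    A zigzag number is the number of classes only because this number is finite:
    the Euler characteristic bounds the graph, the heights of the vertices are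
    prescribed, and no weight exceeds the flow through a level, which is the sum
    of the entries of the left partition ([class_number_covers]). *)

(** * Euler characteristic and flow bounds for tropical covers *)

Section Euler.
Variables (R : realType) (C : metric_graph R).

(** Double counting of incidences, with a weight for each vertex. *)
Lemma handshake (F : vert C -> nat) :
  (\sum_(v : vert C) F v * valence v = \sum_(e : edge C) (F (src e) + F (tgt e)))%N.
Proof.
have h (f : edge C -> vert C) :
    (\sum_v F v * #|[pred e : edge C | f e == v]| = \sum_e F (f e))%N.
  rewrite (partition_big f predT) //=; apply: eq_bigr => v _.
  rewrite (eq_bigr (fun=> F v)) => [|e /eqP -> //].
  by rewrite sum_nat_const mulnC.
by rewrite big_split /= -(h (@src R C)) -(h (@tgt R C)) -big_split;
  apply: eq_bigr => v _; rewrite /= /valence mulnDr.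
Qed.

Lemma incident_sym : symmetric (@incident R C).
Proof. by move=> [v|e] [v'|e']. Qed.

Lemma adj_in_sym (A : {set cell C}) : symmetric (adj_in A).
Proof. by move=> x y; rewrite /adj_in incident_sym; do 2 case: (_ \in A). Qed.

Lemma n_comp_connected : connected_cells [set: cell C] ->
  n_comp (adj_in [set: cell C]) (cell C) = 1%N.
Proof.
move=> [/set0Pn [x _] h].
rewrite -(n_comp_connect (sym_connect_sym (adj_in_sym [set: cell C])) x).
by apply: eq_n_comp_r => y; rewrite [RHS]inE h ?inE.
Qed.

(** With V = inner + leaves, 2E = 3 inner + leaves and a single component, the
    definition g = E - V + 1 becomes inner + 2 = leaves + 2g.  The inequality
    survives the truncated subtraction and bounds the graph; the implication
    computes the genus from a count of vertices. *)
Lemma trivalent_betti1 : tropical_curve C ->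
  (#|[pred v : vert C | is_inner v]| + 2 <=
     #|[pred v : vert C | is_leaf v]| + 2 * betti1 C)%N /\
  forall g, (#|[pred v : vert C | is_inner v]| + 2 =
     #|[pred v : vert C | is_leaf v]| + 2 * g)%N -> betti1 C = g.
Proof.
move=> [hc hv _].
have hE : (#|[pred v : vert C | is_leaf v]| +
    3 * #|[pred v : vert C | is_inner v]| = 2 * #|edge C|)%N.
  have := handshake (fun=> 1%N); rewrite sum_nat_const addnn -muln2.
  rewrite [_ #|edge C|]/= mulnC muln2 -mul2n => <-.
  rewrite -!sum1_card big_distrr /= (big_mkcond (@is_inner _ _)).
  rewrite (big_mkcond (@is_leaf _ _)) -big_split /=.
  apply: eq_bigr => v _; rewrite mul1n; have := hv v.
  by rewrite /is_leaf /is_inner; case/orP => /eqP ->.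
have hV : (#|vert C| = #|[pred v : vert C | is_leaf v]| +
    #|[pred v : vert C | is_inner v]|)%N.
  rewrite -!sum1_card (big_mkcond (@is_inner _ _)).
  rewrite (big_mkcond (@is_leaf _ _)) -big_split /=.
  apply: eq_bigr => v _; have := hv v.
  by rewrite /is_leaf /is_inner; case/orP => /eqP ->.
by rewrite /betti1 n_comp_connected //; split=> [|g]; lia.
Qed.

End Euler.

Section CoverFacts.
Variables (R : realType) (g : nat) (la mu : seq nat) (y : seq R).
Variables (c : cover_data R) (hc : tropical_cover g la mu y c).
Local Notation phi := (phi c).
Local Notation wt := (wt c).

Lemma inner_phi v : is_inner v -> exists2 r, r \in y & phi v = r%:E.
Proof.
case: hc => _ [him _] _ _ _ hv.
have : (phi @` [set v | is_inner v])%classic (phi v) by exists v.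
by rewrite him => -[r hr <-]; exists r.
Qed.

Lemma not_leaf_inner (v : vert c) : ~~ is_leaf v -> is_inner v.
Proof. by case: hc => [[[_ /(_ v) + _] _] _ _ _ _] => /orP[->|]. Qed.

(** On an inner edge the slope equation is between reals; on an end both sides
    are +oo, which leaves only -oo as the lower value or +oo as the upper one. *)
Lemma phi_lt e : (phi (src e) < phi (tgt e))%E.
Proof.
case: hc => [[[_ _ hl] _] [_ hlf] /(_ e) [w0 hs] _ _].
move: (hl e); case: ifP => [_ he|].
  move: hs; rewrite he gt0_muley ?lte_fin ?ltr0n //.
  by case: (phi (src e)) => [a||]; case: (phi (tgt e)) => [b||];
    rewrite //= ?ltry ?ltNyr.
move=> /negbT; rewrite negb_or => /andP[/not_leaf_inner h1 /not_leaf_inner h2].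
case=> l l0 he; move: hs; rewrite he.
case: (inner_phi h1) => a _ ->; case: (inner_phi h2) => b _ -> [].
rewrite lte_fin => /eqP; rewrite subr_eq => /eqP ->.
by rewrite ltrDr mulr_gt0 // ltr0n.
Qed.

Lemma leaf_phi v : is_leaf v -> phi v = -oo%E \/ phi v = +oo%E.
Proof. by case: hc => _ [_ h] _ _ _; apply: h. Qed.

Lemma phiNy_leaf v : phi v = -oo%E -> is_leaf v.
Proof.
move=> hv; apply: contraT => /not_leaf_inner /inner_phi [r _].
by rewrite hv.
Qed.

Lemma phiy_leaf v : phi v = +oo%E -> is_leaf v.
Proof.
move=> hv; apply: contraT => /not_leaf_inner /inner_phi [r _].
by rewrite hv.
Qed.

Lemma tgt_neqNy e : phi (tgt e) <> -oo%E.
Proof. by move=> h; have := phi_lt e; rewrite h ltNge leNye. Qed.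

Lemma src_neqy e : phi (src e) <> +oo%E.
Proof. by move=> h; have := phi_lt e; rewrite h ltNge leey. Qed.

(** A leaf at -oo has a single edge, and is its source since the map increases. *)
Lemma ends_left : size la = #|[pred v | phi v == -oo%E]|.
Proof.
case: hc => _ _ _ _ [/perm_size <- _]; rewrite size_map size_filter.
rewrite -sum1_count big_enum_cond /= .
rewrite (partition_big (@src R c) (fun v => phi v == -oo%E)) //=.
rewrite -sum1_card; apply: eq_bigr => v /= /eqP hv.
have := phiNy_leaf hv; rewrite /is_leaf /valence.
rewrite (@eq_card0 _ [pred e | tgt e == v]) => [|e]; last first.
  by rewrite inE; apply/negP => /eqP he; apply: (@tgt_neqNy e); rewrite he.
rewrite addn0 => /eqP h1; rewrite -[RHS]h1 -sum1_card. apply: eq_bigl => e /=.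
by rewrite inE andbC; case: (eqVneq (src e) v) => [->|]//=; rewrite hv.
Qed.

Lemma ends_right : size mu = #|[pred v | phi v == +oo%E]|.
Proof.
case: hc => _ _ _ _ [_ /perm_size <-]; rewrite size_map size_filter.
rewrite -sum1_count big_enum_cond /= .
rewrite (partition_big (@tgt R c) (fun v => phi v == +oo%E)) //=.
rewrite -sum1_card; apply: eq_bigr => v /= /eqP hv.
have := phiy_leaf hv; rewrite /is_leaf /valence.
rewrite (@eq_card0 _ [pred e | src e == v]) => [|e]; last first.
  by rewrite inE; apply/negP => /eqP he; apply: (@src_neqy e); rewrite he.
rewrite add0n => /eqP h1; rewrite -[RHS]h1 -sum1_card; apply: eq_bigl => e /=.
by rewrite inE andbC; case: (eqVneq (tgt e) v) => [->|]//=; rewrite hv.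
Qed.

Lemma card_leaves : #|[pred v : vert c | is_leaf v]| = (size la + size mu)%N.
Proof.
rewrite ends_left ends_right -!sum1_card (big_mkcond (fun v => phi v == +oo%E)).
rewrite (big_mkcond (fun v => phi v == -oo%E)) -big_split big_mkcond /=.
apply: eq_bigr => v _.
case: ifP => [/leaf_phi [] -> //|/negP h].
case: eqP => [/phiNy_leaf //|_]; case: eqP => [/phiy_leaf //|//].
Qed.

Lemma card_inner_le :
  (#|[pred v : vert c | is_inner v]| <= size la + size mu + 2 * g)%N.
Proof.
case: hc => -[ht hb] _ _ _ _; rewrite -card_leaves.
by have [+ _] := trivalent_betti1 ht; rewrite hb; lia.
Qed.

Lemma card_vert_le : (#|vert c| <= 2 * (size la + size mu) + 2 * g)%N.
Proof.
have h := card_inner_le; have <- : (#|[pred v : vert c | is_leaf v]| +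
    #|[pred v : vert c | is_inner v]| = #|vert c|)%N; last first.
  by rewrite card_leaves; lia.
rewrite -!sum1_card (big_mkcond (@is_inner _ _)).
rewrite (big_mkcond (@is_leaf _ _)) -big_split /=.
apply: eq_bigr => v _; case: hc => -[[_ /(_ v) + _] _] _ _ _ _.
by rewrite /is_leaf /is_inner; case/orP => /eqP ->.
Qed.

Lemma card_edge_le : (#|edge c| <= 3 * (size la + size mu) + 3 * g)%N.
Proof.
have := card_vert_le; have := handshake (C := c) (fun=> 1%N).
rewrite sum_nat_const addnn -muln2 => h hv.
have : (2 * #|edge c| <= 3 * #|vert c|)%N; last by lia.
have -> : (2 * #|edge c| = #|edge c| * (1 * 2))%N by lia.
rewrite -h mulnC -sum_nat_const; apply: leq_sum => v _.
case: hc => -[[_ /(_ v) + _] _] _ _ _ _.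
by rewrite /is_leaf /is_inner; case/orP => /eqP ->.
Qed.

(** Let r be the height of the source of the edge.  By balancing, the total
    weight of the edges crossing the level r upwards is the total weight of the
    ends at -oo, and the given edge is one of those crossing. *)
Lemma wt_le e : (wt e <= sumn la)%N.
Proof.
pose r := phi (src e).
have hry : r <> +oo%E by exact: src_neqy.
case: hc => _ _ _ hbal [/perm_sumn <- _].
rewrite sumnE big_map big_filter big_enum_cond /=.
pose S (f : edge c -> vert c) := (\sum_(e | (phi (f e) <= r)%E) wt e)%N.
have hS (f : edge c -> vert c) :
    S f = (\sum_(v | (phi v <= r)%E) \sum_(e | f e == v) wt e)%N.
  rewrite /S (partition_big f (fun v => (phi v <= r)%E)) //=.
  apply: eq_bigr => v hv; apply: eq_bigl => e' /=.
  by rewrite andbC; case: eqP => [->|].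
have h1 : (wt e + S (@tgt R c) <= S (@src R c))%N.
  rewrite {2}/S (bigD1 e) //= leq_add2l /S.
  rewrite [X in (X <= _)%N]big_mkcond [X in (_ <= X)%N]big_mkcond /=.
  apply: leq_sum => e' _; case: ifP => // h.
  rewrite (le_trans (ltW (phi_lt e')) h) /=; case: eqP => // he.
  by move: h; rewrite he leNgt phi_lt.
have h2 : (S (@src R c) <= \sum_(e | phi (src e) == -oo%E) wt e +
    S (@tgt R c))%N.
  rewrite !hS (bigID (fun v => phi v == -oo%E)) /=.
  apply: leq_add.
    rewrite (partition_big (@src R c) (fun v => phi v == -oo%E)) //=.
    rewrite [X in (X <= _)%N]big_mkcond [X in (_ <= X)%N]big_mkcond /=.
    apply: leq_sum => v _; case: (eqVneq (phi v) -oo%E) => hv.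
      rewrite andbT; case: ifP => // _.
      rewrite [X in (X <= _)%N]big_mkcond [X in (_ <= X)%N]big_mkcond /=.
      apply: leq_sum => e' _; case: eqP => [->|]; last by rewrite andbF.
      by rewrite hv eqxx.
    by rewrite andbF.
  rewrite [X in (X <= _)%N]big_mkcond [X in (_ <= X)%N]big_mkcond /=.
  apply: leq_sum => v _; case: ifP => // /andP[hv1 hv2]; rewrite hv1.
  rewrite hbal //; apply: not_leaf_inner; apply/negP => /leaf_phi[] h.
    by rewrite h in hv2.
  by move: hv1; rewrite h leye_eq => /eqP.
by rewrite -(leq_add2r (S (@tgt R c))); apply: leq_trans h1 h2.
Qed.

End CoverFacts.

(** * Isomorphism classes of covers are finitely many *)

Section ClassNumber.
Variables (T : Type) (A : T -> Prop) (E : T -> T -> Prop).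
Hypothesis Esym : forall x y, E x y -> E y x.
Hypothesis Etrans : forall x y z, E x y -> E y z -> E x z.

(** Any family of pairwise inequivalent objects has distinct codes, so the
    sizes of such families are bounded; a family of maximal size represents all
    classes. *)
Lemma class_number_exists (F : finType) (code : T -> F) :
  (forall x y, A x -> A y -> code x = code y -> E x y) ->
  exists n, has_class_number A E n.
Proof.
move=> hcode.
pose Q k := `[< exists r : 'I_k -> T, (forall i, A (r i)) /\
                  forall i j, E (r i) (r j) -> i = j >].
have Q0 : exists k, Q k.
  by exists 0%N; apply/asboolP; exists
      (fun i : 'I_0 => False_rect T (notF (ltn_ord i))); split => -[].
have QF k : Q k -> (k <= #|F|)%N.
  move=> /asboolP[r [hA hE]]; rewrite -[k]card_ord.
  by apply: (@leq_card _ _ (code \o r)) => i j /= /(hcode _ _ (hA _) (hA _))/hE.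
case: (ex_maxnP Q0 QF) => n /asboolP[r [hA hE]] hmax.
exists n, r; split=> // x hx; apply: contrapT => hno.
suff /hmax : Q n.+1 by rewrite ltnn.
apply/asboolP; exists (fun i => if unlift ord_max i is Some j then r j else x).
split=> [i|i j]; first by case: (unlift _ i).
case: unliftP => [i' ->|->]; case: unliftP => [j' ->|->] //.
- by move=> /hE ->.
- by move=> /Esym h; case: hno; exists i'.
- by move=> h; case: hno; exists j'.
Qed.

Lemma class_number_ge (F : finType) (f : F -> T) n :
  (forall i, A (f i)) -> (forall i j, E (f i) (f j) -> i = j) ->
  has_class_number A E n -> (#|F| <= n)%N.
Proof.
move=> hA hE [r [_ _ hr]].
have /choice[h hh] i : exists j, E (f i) (r j) by apply: hr.
rewrite -[n]card_ord; apply: (@leq_card _ _ h) => i j hij; apply: hE.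
by apply: Etrans (hh i) _; rewrite hij; apply: Esym.
Qed.

End ClassNumber.

Section CoverIso.
Variable R : realType.
Implicit Types c d : cover_data R.

Lemma joinsC (C : metric_graph R) (e : edge C) u v : joins e u v = joins e v u.
Proof. by rewrite /joins orbC. Qed.

Lemma cover_iso_sym c d : cover_iso c d -> cover_iso d c.
Proof.
move=> [fV [fE [[[gV hV1 hV2] [gE hE1 hE2] hj hl] hp hw]]].
exists gV, gE; split; first split.
- by exists fV.
- by exists fE.
- move=> e; have := hj (gE e); rewrite hE2 /joins.
  case/orP => /andP[/eqP -> /eqP ->]; rewrite !hV1 !eqxx ?orbT //.
- by move=> e; rewrite -hl hE2.
- by move=> v; rewrite -hp hV2.
- by move=> e; rewrite -hw hE2.
Qed.

Lemma cover_iso_trans c d f : cover_iso c d -> cover_iso d f -> cover_iso c f.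
Proof.
move=> [fV [fE [[bV bE hj hl] hp hw]]] [gV [gE [[bV' bE' hj' hl'] hp' hw']]].
exists (gV \o fV), (gE \o fE); split; first split.
- exact: bij_comp.
- exact: bij_comp.
- move=> e /=; have := hj' (fE e); have := hj e; rewrite {1}/joins.
  by case/orP => /andP[/eqP -> /eqP ->]; rewrite // joinsC.
- by move=> e /=; rewrite hl' hl.
- by move=> v /=; rewrite hp' hp.
- by move=> e /=; rewrite hw' hw.
Qed.

(** Enumerations identify two finite types of the same cardinality; this is how
    equal codes of two curves yield an isomorphism. *)
Definition transfer (T U : finType) (h : #|T| = #|U|) (x : T) : U :=
  enum_val (cast_ord h (enum_rank x)).

Lemma transfer_rank (T U : finType) (h : #|T| = #|U|) x :
  enum_rank (transfer h x) = enum_rank x :> nat.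
Proof. by rewrite /transfer enum_valK. Qed.

Lemma transfer_bij (T U : finType) (h : #|T| = #|U|) : bijective (transfer h).
Proof.
exists (transfer (esym h)) => x;
  by rewrite /transfer enum_valK ?cast_ordK ?cast_ordKV enum_rankK.
Qed.

Lemma nth_map_enum (T : finType) (U : Type) (u : U) (f : T -> U) x :
  nth u [seq f z | z <- enum T] (enum_rank x) = f x.
Proof.
rewrite (nth_map x) ?nth_enum_rank //.
by apply: leq_trans (ltn_ord (enum_rank x)) _; rewrite cardT.
Qed.

Lemma size_map_enum (T : finType) (U : Type) (f : T -> U) :
  size [seq f z | z <- enum T] = #|T|.
Proof. by rewrite size_map cardT. Qed.

Variables (g : nat) (la mu : seq nat) (y : seq R).

Definition heights : seq \bar R := -oo%E :: +oo%E :: [seq r%:E | r <- y].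

Lemma phi_heights c (v : vert c) :
  tropical_cover g la mu y c -> phi _ v \in heights.
Proof.
move=> hc; rewrite /heights !inE; case: (boolP (is_leaf v)) => hv.
  by case: (leaf_phi hc hv) => ->; rewrite eqxx ?orbT.
have [r hr ->] := inner_phi hc (not_leaf_inner hc hv).
by rewrite map_f ?orbT.
Qed.

Definition vcode c : seq nat := [seq index (phi _ v) heights | v <- enum (vert c)].
Definition ecode c : seq (nat * nat * nat) :=
  [seq (nat_of_ord (enum_rank (src e)), nat_of_ord (enum_rank (tgt e)), wt _ e)
    | e <- enum (edge c)].

(** The lengths are not part of the code: the slope equation determines them on
    inner edges, and on ends they are infinite. *)
Lemma codes_iso c d : tropical_cover g la mu y c -> tropical_cover g la mu y d ->
  vcode c = vcode d -> ecode c = ecode d -> cover_iso c d.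
Proof.
move=> hc hd hv he.
have eV : #|vert c| = #|vert d|.
  by move/(congr1 size): hv; rewrite !size_map_enum.
have eE : #|edge c| = #|edge d|.
  by move/(congr1 size): he; rewrite !size_map_enum.
have hphi v : phi _ (transfer eV v) = phi _ v.
  have := congr1 (nth 0%N ^~ (enum_rank v)) hv.
  rewrite /= /vcode nth_map_enum -(transfer_rank eV) nth_map_enum => h.
  rewrite -[LHS](nth_index -oo%E (phi_heights (transfer eV v) hd)) -h.
  by rewrite nth_index // (phi_heights _ hc).
have [hs [ht hw]] : (forall e : edge c, src (transfer eE e) = transfer eV (src e)) /\
  (forall e : edge c, tgt (transfer eE e) = transfer eV (tgt e)) /\
  (forall e : edge c, wt _ (transfer eE e) = wt _ e).
  have h (e : edge c) := congr1 (nth (0%N,0%N,0%N) ^~ (enum_rank e)) he.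
  have {}h (e : edge c) : [/\ enum_rank (src (transfer eE e)) = enum_rank (src e) :>
      nat,
     enum_rank (tgt (transfer eE e)) = enum_rank (tgt e) :> nat &
         wt _ (transfer eE e) = wt _ e].
    have := h e; rewrite /= /ecode nth_map_enum -(transfer_rank eE) nth_map_enum.
    by case.
  by split; [|split] => e; case: (h e) => // h1 h2 h3; apply: enum_rank_inj;
    apply: val_inj; rewrite /= transfer_rank.
exists (transfer eV), (transfer eE); split=> //; split.
- exact: transfer_bij.
- exact: transfer_bij.
- by move=> e; rewrite /joins hs ht !eqxx.
move=> e; move: (hd) (hc) => [[[_ _ /(_ (transfer eE e)) ld] _] _ /(_ (transfer eE e))
    [tail_word ed] _ _].
move=> [[[_ _ /(_ e) lc] _] _ /(_ e) [wc ec] _ _].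
have : ((wt _ e)%:R%:E * len (transfer eE e) = (wt _ e)%:R%:E * len e)%E.
  by rewrite -ec -{1}hw -ed hs ht !hphi.
have w0 : (0 : R) < (wt _ e)%:R by rewrite ltr0n.
have w0' : (wt _ e)%:R != 0 :> R by rewrite gt_eqF.
case: ifP lc => _ => [->|[l l0 ->]]; case: ifP ld => _ => [->|[l' l0' ->]] //.
- by rewrite gt0_muley ?lte_fin.
- by rewrite gt0_muley ?lte_fin.
- by case=> /(mulfI w0') ->.
Qed.

Lemma class_number_covers (Z : cover_data R -> Prop) : exists n,
  has_class_number (fun c => tropical_cover g la mu y c /\ Z c) (@cover_iso R) n.
Proof.
(* bounds the numbers of vertices and edges, the weights and the indices of heights *)
pose B := (3 * (size la + size mu) + 3 * g + sumn la + size heights)%N.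
pose code c : 3.-tuple 'I_B.+1 *
    ({ffun 'I_B.+1 -> 'I_B.+1} * {ffun 'I_B.+1 -> ('I_B.+1 * 'I_B.+1) * 'I_B.+1}) :=
  ([tuple inord (size (vcode c)); inord (size (ecode c)); inord 0],
   ([ffun i : 'I_B.+1 => inord (nth 0%N (vcode c) i)],
    [ffun i : 'I_B.+1 => let z := nth (0%N,0%N,0%N) (ecode c) i in
       ((inord z.1.1, inord z.1.2), inord z.2)])).
apply: (@class_number_exists _ _ _ (@cover_iso_sym) _ code).
have sv c : tropical_cover g la mu y c -> (size (vcode c) <= B)%N.
  by move=> /card_vert_le; rewrite size_map_enum /B; lia.
have se c : tropical_cover g la mu y c -> (size (ecode c) <= B)%N.
  by move=> /card_edge_le; rewrite size_map_enum /B; lia.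
have inordI a b : (a <= B)%N -> (b <= B)%N ->
    inord a = inord b :> 'I_B.+1 -> a = b.
  by move=> ha hb /(congr1 val); rewrite /= !inordK.
have nv c i : tropical_cover g la mu y c -> (nth 0%N (vcode c) i <= B)%N.
  move=> hc; case: (ltnP i (size (vcode c))) => hi; last by rewrite nth_default.
  suff /allP h : all (leq^~ B) (vcode c) by apply: h; apply: mem_nth.
  rewrite all_map; apply/allP => v _;
      rewrite [preim _ _ _]/(index (phi _ v) heights <= B)%N.
  by rewrite /B; apply: leq_trans (index_size (phi _ v) heights) _; rewrite leq_addl.
have ne c i : tropical_cover g la mu y c ->
   let z := nth (0%N,0%N,0%N) (ecode c) i in
   [/\ (z.1.1 <= B)%N, (z.1.2 <= B)%N & (z.2 <= B)%N].
  move=> hc; case: (ltnP i (size (ecode c))) => hi; last by rewrite nth_default.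
  move=> z; have : z \in ecode c by apply: mem_nth.
  have := card_vert_le hc => hb.
  case/mapP => e _ -> /=; split.
  - by apply: leq_trans (ltnW (ltn_ord (enum_rank (src e)))) (leq_trans hb _);
      rewrite /B; lia.
  - by apply: leq_trans (ltnW (ltn_ord (enum_rank (tgt e)))) (leq_trans hb _);
      rewrite /B; lia.
  - by have := wt_le hc e; rewrite /B; lia.
move=> c d [hc _] [hd _] [] h1 h2 /ffunP hv /ffunP he.
have {}h1 := inordI _ _ (sv _ hc) (sv _ hd) h1.
have {}h2 := inordI _ _ (se _ hc) (se _ hd) h2.
apply: codes_iso => //.
  apply: (eq_from_nth (x0 := 0%N) h1) => i hi.
  have hiB : (i < B.+1)%N by rewrite ltnS ltnW // (leq_trans hi) ?sv.
  by have := hv (Ordinal hiB); rewrite !ffunE /=; apply: inordI; apply: nv.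
apply: (eq_from_nth (x0 := (0%N,0%N,0%N)) h2) => i hi.
have hiB : (i < B.+1)%N by rewrite ltnS ltnW // (leq_trans hi) ?se.
have := he (Ordinal hiB); rewrite !ffunE /=.
have [+ + +] := ne c i hc; have [+ + +] := ne d i hd.
case: (nth _ _ _) => -[a1 a2] a3; case: (nth _ _ _) => -[b1 b2] b3 /=.
move=> ? ? ? ? ? ? [] /inordI -> // /inordI -> // /inordI -> //.
Qed.

(** The only form in which zigzag numbers are bounded from below: finiteness of
    the set of classes guarantees that the number is not the default value. *)
Lemma zigzag_number_ge (F : finType) (f : F -> cover_data R) :
  (forall i, tropical_cover g la mu y (f i) /\ zigzag (f i)) ->
  (forall i j, cover_iso (f i) (f j) -> i = j) ->
  (#|F| <= zigzag_number g la mu y)%N.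
Proof.
move=> hA hE.
apply: (class_number_ge (@cover_iso_sym) (@cover_iso_trans) hA hE).
rewrite /zigzag_number.
have := class_number_covers (@zigzag R); exact: getPex.
Qed.

End CoverIso.

(** * Covers glued from a string and tails *)

Section Construction.
Variables (R : realType) (t N : nat).
Variables (lft frk : 'I_N -> bool) (kk : 'I_N -> nat) (s : nat -> int).
Variable height : 'I_t -> R.
Variables (lab : 'I_t -> 'I_N) (att : 'I_N -> 'I_t).

(** The inner vertices are the ordinals below [t], ordered as their heights;
    [lab] tells the tail of a vertex, and [att i] is the vertex at which tail
    [i] meets the string.  A chain starts at the outer end of the tail, so that
    it increases for tails on the left and decreases for tails on the right. *)
Definition chain (i : 'I_N) : seq 'I_t :=
  let o := [seq q <- enum 'I_t | lab q == i] in if lft i then o else rev o.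
Definition chain_index q : nat := index q (chain (lab q)).
Definition outward q := nth q (chain (lab q)) (chain_index q).-1.
Definition inward q := nth q (chain (lab q)) (chain_index q).+1.
Definition is_attach q := (chain_index q).+1 == size (chain (lab q)).
(** Whether the outer side of the vertex consists of two edges of weight [k] (a
    cycle, or the fork at the start of the chain) or of one edge of weight [2k].
    The two cases alternate along a chain, and a fork fixes the first one. *)
Definition doubled q := frk (lab q) (+) odd (chain_index q).

(** Every edge of a tail is on the outer side of exactly one vertex; the boolean
    distinguishes the two edges of a doubled side. *)
Definition slot := {x : 'I_t * bool | doubled x.1 || ~~ x.2}.
(** The leaves of a tail correspond to the edges on the outer side of the first
    vertex of its chain. *)
Definition leafslot :=
  {x : 'I_t * bool | (chain_index x.1 == 0%N) && (doubled x.1 || ~~ x.2)}.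
Definition zvert : finType := ('I_t + (leafslot + bool))%type.
(** The edges of the string are numbered along it: edge [j] goes from the
    attachment of tail [j - 1] to that of tail [j], where the missing attachments
    at both extremes are the two leaves of the string. *)
Definition zedge : finType := (slot + 'I_N.+1)%type.

Definition outer_end (x : 'I_t * bool) : zvert :=
  if (insub x : option leafslot) is Some l then inr (inl l) else inl (outward x.1).
Definition str_start (j : 'I_N.+1) : zvert :=
  if unlift ord0 j is Some i then inl (att i) else inr (inr false).
Definition str_stop (j : 'I_N.+1) : zvert :=
  if unlift ord_max j is Some i then inl (att i) else inr (inr true).

(** Edges of tails are directed towards the string, those of the string along it;
    the cover increases in this direction iff [rightward] holds. *)
Definition edge_start (e : zedge) : zvert :=
  match e with inl x => outer_end (val x) | inr j => str_start j end.
Definition edge_stop (e : zedge) : zvert :=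
  match e with inl x => inl (val x).1 | inr j => str_stop j end.
Definition rightward (e : zedge) : bool :=
  match e with inl x => lft (lab (val x).1) | inr j => 0 < s j end.
Definition zsrc e := if rightward e then edge_start e else edge_stop e.
Definition ztgt e := if rightward e then edge_stop e else edge_start e.
Definition outer_wt q := if doubled q then kk (lab q) else (2 * kk (lab q))%N.
Definition zwt (e : zedge) : nat :=
  match e with inl x => outer_wt (val x).1 | inr j => `|s j|%N end.
Definition zphi (v : zvert) : \bar R :=
  match v with
  | inl q => (height q)%:E
  | inr (inl l) => if lft (lab (val l).1) then -oo%E else +oo%E
  | inr (inr false) => if 0 < s 0 then -oo%E else +oo%E
  | inr (inr true) => if 0 < s N then +oo%E else -oo%E
  end.
(** The slope equation solved for the length; on ends this is [+oo]. *)
Definition zlen e : \bar R :=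
  (((zwt e)%:R^-1)%:E * (zphi (ztgt e) - zphi (zsrc e)))%E.

Definition zgraph : metric_graph R := MetricGraph zsrc ztgt zlen.
Definition zcover : cover_data R := @CoverData R zgraph zphi zwt.

Section Chains.
Hypothesis labatt : forall i, lab (att i) = i.
Hypothesis is_attach_att : forall i, is_attach (att i).

Lemma mem_chain i q : (q \in chain i) = (lab q == i).
Proof.
by rewrite /chain; case: ifP => _; rewrite ?mem_rev mem_filter mem_enum andbT.
Qed.

Lemma uniq_chain i : uniq (chain i).
Proof.
by rewrite /chain; case: ifP => _; rewrite ?rev_uniq filter_uniq ?enum_uniq.
Qed.

Lemma chain_index_lt q : (chain_index q < size (chain (lab q)))%N.
Proof. by rewrite index_mem mem_chain. Qed.

Lemma nth_chain_index q0 q : nth q0 (chain (lab q)) (chain_index q) = q.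
Proof. by rewrite nth_index // mem_chain. Qed.

Lemma lab_nth_chain q0 i r : (r < size (chain i))%N -> lab (nth q0 (chain i) r) = i.
Proof. by move=> h; apply/eqP; rewrite -mem_chain mem_nth. Qed.

Lemma chain_index_nth q0 i r : (r < size (chain i))%N ->
    chain_index (nth q0 (chain i) r) = r.
Proof. by move=> h; rewrite /chain_index lab_nth_chain // index_uniq // uniq_chain. Qed.

Lemma lab_chain_index_inj q q' : lab q = lab q' -> chain_index q = chain_index q' ->
    q = q'.
Proof. by move=> h1 h2; rewrite -(nth_chain_index q q) h1 h2 nth_chain_index. Qed.

Lemma outward_index_lt q : ((chain_index q).-1 < size (chain (lab q)))%N.
Proof. by apply: leq_ltn_trans (leq_pred _) (chain_index_lt q). Qed.

Lemma lab_outward q : lab (outward q) = lab q.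
Proof. by rewrite lab_nth_chain // outward_index_lt. Qed.

Lemma chain_index_outward q : chain_index (outward q) = (chain_index q).-1.
Proof. by rewrite chain_index_nth // outward_index_lt. Qed.

Lemma lab_inward q : ~~ is_attach q -> lab (inward q) = lab q.
Proof. by move=> h; rewrite lab_nth_chain // ltn_neqAle h chain_index_lt. Qed.

Lemma chain_index_inward q : ~~ is_attach q ->
    chain_index (inward q) = (chain_index q).+1.
Proof. by move=> h; rewrite chain_index_nth // ltn_neqAle h chain_index_lt. Qed.

Lemma inwardK q : ~~ is_attach q -> outward (inward q) = q.
Proof. by move=> h; apply: lab_chain_index_inj;
    rewrite ?lab_outward ?chain_index_outward ?lab_inward ?chain_index_inward. Qed.

Lemma outward_not_attach q : (0 < chain_index q)%N -> ~~ is_attach (outward q).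
Proof.
rewrite /is_attach chain_index_outward lab_outward => h; have := chain_index_lt q.
by rewrite prednK //; apply: contraL => /eqP ->; rewrite ltnn.
Qed.

Lemma outwardK q : (0 < chain_index q)%N -> inward (outward q) = q.
Proof.
move=> h; have h' := outward_not_attach h.
by apply: lab_chain_index_inj; rewrite ?lab_inward ?chain_index_inward ?lab_outward //
    chain_index_outward prednK.
Qed.

Lemma outward_eq q q' : ((0 < chain_index q')%N && (outward q' == q))
    = (~~ is_attach q && (q' == inward q)).
Proof.
apply/andP/andP => [[h /eqP <-]|[h /eqP ->]].
  by rewrite outwardK // outward_not_attach.
by rewrite chain_index_inward // inwardK.
Qed.

Lemma is_attachE q : is_attach q = (att (lab q) == q).
Proof.
apply/idP/eqP => [/eqP h|<-]; last by rewrite is_attach_att.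
apply: lab_chain_index_inj; rewrite ?labatt //; apply/eqP.
by rewrite -eqSS h; have := is_attach_att (lab q); rewrite /is_attach labatt.
Qed.

Lemma doubled_inward q : ~~ is_attach q -> doubled (inward q) = ~~ doubled q.
Proof. by move=> h; rewrite /doubled lab_inward // chain_index_inward //= addbN. Qed.

Lemma chain_sorted i : sorted (fun q q' : 'I_t =>
    if lft i then (q < q')%N else (q' < q)%N) (chain i).
Proof.
have h : sorted (fun q q' : 'I_t => (q < q')%N) [seq q <- enum 'I_t | lab q == i].
  apply: sorted_filter => [a b d|]; first exact: ltn_trans.
  by have := iota_ltn_sorted 0 t; rewrite -val_enum_ord sorted_map.
by rewrite /chain; case: ifP => hl; rewrite ?rev_sorted.
Qed.

Lemma outward_order q : (0 < chain_index q)%N ->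
  if lft (lab q) then (outward q < q)%N else (q < outward q)%N.
Proof.
move=> h.
have /(sortedP q)/(_ (chain_index q).-1) := chain_sorted (lab q).
by rewrite prednK // chain_index_lt nth_chain_index => /(_ isT).
Qed.

Lemma outer_end_leaf (l : leafslot) : outer_end (val l) = inr (inl l).
Proof. by rewrite /outer_end valK. Qed.

Lemma outer_end0 x : doubled x.1 || ~~ x.2 -> chain_index x.1 = 0%N ->
  exists2 l : leafslot, outer_end x = inr (inl l) & val l = x.
Proof.
move=> h h0; have h' : (chain_index x.1 == 0%N) &&
    (doubled x.1 || ~~ x.2) by rewrite h0 h.
by exists (exist _ x h') => //; rewrite -outer_end_leaf.
Qed.

Lemma outer_endS x : (0 < chain_index x.1)%N -> outer_end x = inl (outward x.1).
Proof. by rewrite lt0n => h; rewrite /outer_end insubN // negb_and h. Qed.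

Lemma outer_end_eq_inl x q : doubled x.1 || ~~ x.2 ->
  (outer_end x == inl q) = ~~ is_attach q && (x.1 == inward q).
Proof.
move=> hx; rewrite -outward_eq; case: (posnP (chain_index x.1)) => h.
  by have [l -> _] := outer_end0 hx h.
by rewrite outer_endS.
Qed.

Lemma outer_end_eq_leaf x (l : leafslot) : (outer_end x == inr (inl l)) = (x == val l).
Proof.
apply/eqP/eqP => [|->]; last exact: outer_end_leaf.
rewrite /outer_end; case: insubP => // u _ hu [<-]; by rewrite hu.
Qed.

Lemma str_start0 : str_start ord0 = inr (inr false).
Proof. by rewrite /str_start unlift_none. Qed.
Lemma str_startS i : str_start (lift ord0 i) = inl (att i).
Proof. by rewrite /str_start liftK. Qed.
Lemma str_stop_max : str_stop ord_max = inr (inr true).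
Proof. by rewrite /str_stop unlift_none. Qed.
Lemma str_stopS i : str_stop (lift ord_max i) = inl (att i).
Proof. by rewrite /str_stop liftK. Qed.

Section Sums.
Variables (M : Type) (idx : M) (op : Monoid.com_law idx).

Lemma big_slot (F : 'I_t * bool -> M) :
  \big[op/idx]_(x : slot) F (val x) =
  \big[op/idx]_q (op (F (q, false)) (if doubled q then F (q, true) else idx)).
Proof.
transitivity (\big[op/idx]_(x | doubled x.1 || ~~ x.2) F x).
  by rewrite (big_sub [pred x : 'I_t * bool | doubled x.1 || ~~ x.2]).
rewrite big_mkcond.
transitivity (\big[op/idx]_q \big[op/idx]_b
    (if doubled q || ~~ b then F (q, b) else idx)).
  by rewrite pair_bigA; apply: eq_bigr => -[].
by apply: eq_bigr => q _; rewrite big_bool /= orbT orbF Monoid.mulmC.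
Qed.

Lemma big_str_start (G : 'I_N.+1 -> zvert -> M) :
  \big[op/idx]_j G j (str_start j) =
  op (G ord0 (inr (inr false))) (\big[op/idx]_i G (lift ord0 i) (inl (att i))).
Proof.
rewrite big_ord_recl str_start0; congr (op _ _).
by apply: eq_bigr => i _; rewrite str_startS.
Qed.

Lemma big_str_stop (G : 'I_N.+1 -> zvert -> M) :
  \big[op/idx]_j G j (str_stop j) =
  op (G ord_max (inr (inr true))) (\big[op/idx]_i G (lift ord_max i) (inl (att i))).
Proof.
rewrite (bigD1_ord ord_max) //= str_stop_max; congr (op _ _).
by apply: eq_bigr => i _; rewrite str_stopS.
Qed.

(** Sums over edges become sums over vertices and string edges; this reduces
    valences, balancing and the weights at infinity to pointwise identities. *)
Lemma big_edges (F : 'I_t * bool -> M) (G : 'I_N.+1 -> M) (H : zedge -> M) :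
  (forall x, H (inl x) = F (val x)) -> (forall j, H (inr j) = G j) ->
  \big[op/idx]_e H e =
  op (\big[op/idx]_q (op (F (q, false)) (if doubled q then F (q, true) else idx)))
     (\big[op/idx]_j G j).
Proof.
move=> hF hG; rewrite big_sumType /= -big_slot.
by congr (op _ _); apply: eq_bigr.
Qed.

End Sums.

Hypothesis Hpar : forall i, odd (size (chain i)) = ~~ frk i.

Lemma doubled_attach q : is_attach q -> doubled q = false.
Proof.
rewrite /doubled => /eqP h; have := Hpar (lab q).
by rewrite -h /=; case: (frk _); case: (odd _).
Qed.

Lemma sum_pred1 (T : finType) (x : T) (F : T -> nat) :
  (\sum_z (z == x) * F z = F x)%N.
Proof.
rewrite (bigD1 x) //= eqxx mul1n big1 ?addn0 // => z /negbTE ->.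
by rewrite mul0n.
Qed.

Lemma src_tgt_sum (v : zvert) e :
  ((zsrc e == v) + (ztgt e == v) = (edge_start e == v) + (edge_stop e == v))%N.
Proof. by rewrite /zsrc /ztgt; case: (rightward e) => //; rewrite addnC. Qed.

Lemma zvalenceE (v : vert zgraph) : valence v =
  (\sum_q (((outer_end (q, false) == v) + (inl q == v :> zvert)) +
     (if doubled q then (outer_end (q, true) == v) + (inl q == v :> zvert) else 0)) +
   (\sum_j (str_start j == v) + \sum_j (str_stop j == v)))%N.
Proof.
rewrite /valence; transitivity (\sum_e ((zsrc e == v) + (ztgt e == v)))%N.
  rewrite -!sum1_card big_mkcond [X in (_ + X)%N]big_mkcond -big_split /=.
  by apply: eq_bigr => e _; rewrite !inE; case: eqP; case: eqP.
rewrite (@big_edges _ _ _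
   (fun x => (outer_end x == v) + (inl x.1 == v :> zvert))%N
   (fun j => (str_start j == v) + (str_stop j == v))%N) //.
- by rewrite /= [X in (_ + X)%N]big_split.
- by move=> x; rewrite src_tgt_sum.
- by move=> j; rewrite src_tgt_sum.
Qed.

Lemma sum_str_start_inl q : (\sum_j (str_start j == inl q) = is_attach q)%N.
Proof.
rewrite (big_str_start _ (fun _ v => (v == inl q : nat))) /= add0n.
rewrite (eq_bigr (fun i => (i == lab q) * is_attach q)%N) ?sum_pred1 // => i _.
rewrite is_attachE // (inj_eq (@inl_inj _ _)); case: (eqVneq i (lab q)) => [->|h].
  by rewrite mul1n.
by case: eqP => // h'; move: h; rewrite -h' labatt eqxx.
Qed.

Lemma sum_str_stop_inl q : (\sum_j (str_stop j == inl q) = is_attach q)%N.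
Proof.
rewrite (big_str_stop _ (fun _ v => (v == inl q : nat))) /= add0n.
rewrite (eq_bigr (fun i => (i == lab q) * is_attach q)%N) ?sum_pred1 // => i _.
rewrite is_attachE // (inj_eq (@inl_inj _ _)); case: (eqVneq i (lab q)) => [->|h].
  by rewrite mul1n.
by case: eqP => // h'; move: h; rewrite -h' labatt eqxx.
Qed.

(** Away from the string one side of the vertex is doubled and the other is not;
    an attachment has one outer edge and two string edges. *)
Lemma valence_inl q : @valence R zgraph (inl q) = 3%N.
Proof.
rewrite zvalenceE sum_str_start_inl sum_str_stop_inl.
rewrite (eq_bigr (fun q' => (q' == inward q) * (~~ is_attach q * (1 + ~~ doubled q)) +
   (q' == q) * (1 + doubled q))%N); last first.
  move=> q' _; rewrite !(inj_eq (@inl_inj _ _)) outer_end_eq_inl ?orbT //=.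
  rewrite (fun_if (fun n : nat => n)); case: (eqVneq q' q) => [->|hq].
    case: ifP => h; first rewrite outer_end_eq_inl ?h //=.
      by case: (boolP (is_attach q)) => [|/doubled_inward];
          case: (eqVneq q (inward q)) => // <-; rewrite h.
    case: (boolP (is_attach q)) => [|/doubled_inward]; case: (eqVneq q (inward q)) =>
        //= <-; rewrite h //.
  case: ifP => h; first rewrite outer_end_eq_inl ?h //=.
    by case: (boolP (is_attach q)) => [|/doubled_inward hn] //=;
        case: (eqVneq q' (inward q)) => //= hq';
      rewrite -hn -hq' h.
  by case: (boolP (is_attach q)) => [|/doubled_inward hn] //=;
      case: (eqVneq q' (inward q)) => //= hq';
      rewrite -hn -hq' h.
rewrite big_split /= !sum_pred1.
by case: (boolP (is_attach q)) => [/doubled_attach -> //|]; case: (doubled q).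
Qed.

Lemma sum_str_start_inr w : (\sum_j (str_start j == inr w) = (w == inr false))%N.
Proof.
rewrite (big_str_start _ (fun _ v => (v == inr w : nat))) /= big1 // addn0.
by rewrite (inj_eq (@inr_inj _ _)) eq_sym.
Qed.

Lemma sum_str_stop_inr w : (\sum_j (str_stop j == inr w) = (w == inr true))%N.
Proof.
rewrite (big_str_stop _ (fun _ v => (v == inr w : nat))) /= big1 // addn0.
by rewrite (inj_eq (@inr_inj _ _)) eq_sym.
Qed.

Lemma valence_inr w : @valence R zgraph (inr w) = 1%N.
Proof.
rewrite zvalenceE sum_str_start_inr sum_str_stop_inr; case: w => [l|b].
  rewrite !addn0.
  have [h1 h2] := andP (valP l).
  rewrite (eq_bigr (fun q => (q == (val l).1) * 1)%N) ?sum_pred1 // => q _.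
  rewrite !outer_end_eq_leaf /=; case: l h1 h2 => -[q0 b0] /= hl h1 h2.
  rewrite !xpair_eqE muln1 !addn0.
  case: (eqVneq q q0) => [->|] /=; last by case: ifP.
  by case: (doubled q0) b0 h2 {hl} => -[].
rewrite big1 ?add0n; last first.
  move=> q _ ; rewrite !addn0; case: (posnP (chain_index q)) => h; last first.
    by rewrite !outer_endS //; case: ifP.
  have [||l -> _] := @outer_end0 (q, false) => //=; first by rewrite orbT.
  by case: ifP => // hd; have [||l' -> _] := @outer_end0 (q, true) => //=; rewrite hd.
by case: b.
Qed.

Lemma leaf_inr w : @is_leaf R zgraph (inr w).
Proof. by rewrite /is_leaf valence_inr. Qed.

Lemma inner_inl q : @is_inner R zgraph (inl q).
Proof. by rewrite /is_inner valence_inl. Qed.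

Lemma zleafE (v : vert zgraph) : is_leaf v = if v is inr _ then true else false.
Proof. by case: v => [q|w]; rewrite /is_leaf ?valence_inl ?valence_inr. Qed.

Lemma zinnerE (v : vert zgraph) : is_inner v = if v is inl _ then true else false.
Proof. by case: v => [q|w]; rewrite /is_inner ?valence_inl ?valence_inr. Qed.

Hypothesis Hk : forall i, (0 < kk i)%N.
Hypothesis Hs0 : odd `|s 0|.
Hypothesis Hs : forall i : 'I_N,
  s i.+1 = s i + (if lft i then (2 * kk i)%:Z else - (2 * kk i)%:Z).

(** Hence no string edge has weight zero, whatever the order of the tails. *)
Lemma odd_s (j : 'I_N.+1) : odd `|s j|.
Proof.
case: j => j /=; elim: j => [//|j IH] hj.
have := Hs (Ordinal (hj : (j < N)%N)) => /= h.
have := IH (ltnW hj); rewrite h; case: (lft _); lia.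
Qed.

Lemma s_neq0 (j : 'I_N.+1) : s j != 0.
Proof. by have := odd_s j; case: eqP => // ->. Qed.

Lemma zwt_gt0 e : (0 < zwt e)%N.
Proof.
case: e => [x|j] /=; last by rewrite lt0n absz_eq0 s_neq0.
by rewrite /outer_wt; case: ifP; rewrite ?muln_gt0 Hk.
Qed.

(** Flow in the direction from [edge_start] to [edge_stop]. *)
Definition signed_wt (e : zedge) : int :=
    if rightward e then (zwt e)%:Z else - (zwt e)%:Z.

Lemma signed_wt_str j : signed_wt (inr j) = s j.
Proof.
rewrite /signed_wt /=; case: ltP => h; first by rewrite gez0_abs // ltW.
by rewrite lez0_abs ?opprK.
Qed.

Definition signed_tail_wt i : int := if lft i then (2 * kk i)%:Z else - (2 * kk i)%:Z.

(** In the direction towards the string every side of a vertex of a tail carries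
    the flow [signed_tail_wt] of the tail, and the steps of [s] say that at an
    attachment the string absorbs it. *)
Lemma balance q : (\sum_(e | ztgt e == inl q) zwt e = \sum_(e | zsrc e == inl q) zwt
    e)%N.
Proof.
apply/eqP; rewrite -eqz_nat -subr_eq0 !(big_morph Posz PoszD (erefl _)).
rewrite big_mkcond [X in _ - X]big_mkcond -sumrB /=.
rewrite (eq_bigr (fun e => signed_wt e *
    ((edge_stop e == inl q)%:R - (edge_start e == inl q)%:R))); last first.
  move=> e _; rewrite /signed_wt /ztgt /zsrc; case: (rightward e);
      case: (edge_start e == _); case: (edge_stop e == _);
  by rewrite /= ?(mulr1, mulr0, subrr, subr0, sub0r, mulrN1, opprK).
rewrite (@big_edges _ _ _
   (fun x => (if lft (lab x.1) then (outer_wt x.1)%:Z else - (outer_wt x.1)%:Z) *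
     ((x.1 == q)%:R - (outer_end x == inl q)%:R))
   (fun j => s j * ((str_stop j == inl q)%:R - (str_start j == inl q)%:R))); first last.
- by move=> j; rewrite signed_wt_str.
- by move=> x.
rewrite (eq_bigr (fun q' => (q' == q)%:R * signed_tail_wt (lab q)
    - (q' == inward q)%:R * ((~~ is_attach q)%:R * signed_tail_wt (lab q))));
        last first.
  move=> q' _ /=; rewrite outer_end_eq_inl ?orbT //=.
  set B := ~~ is_attach q && (q' == inward q).
  have hB : (q' == inward q)%:R * ((~~ is_attach q)%:R * signed_tail_wt (lab q))
      = B%:R * signed_tail_wt (lab q').
    rewrite /B; case: (boolP (is_attach q)) => h /=; first by rewrite !mul0r mulr0.
    by case: (eqVneq q' (inward q)) => [->|_]; rewrite ?mul0r // lab_inward // !mul1r.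
  have hq : (q' == q)%:R * signed_tail_wt (lab q) = (q' == q)%:R * signed_tail_wt
      (lab q').
    by case: (eqVneq q' q) => [->|_] //; rewrite !mul0r.
  rewrite hB hq /outer_wt /signed_tail_wt.
  case: (boolP (doubled q')) => hd; first rewrite outer_end_eq_inl ?hd // -/B;
    by case: (lft _); rewrite ?PoszM; ring.
rewrite sumrB /=.
have sp (z : 'I_t) (x : int) : \sum_q' (q' == z)%:R * x = x.
  rewrite (bigD1 z) //= eqxx mul1r big1 ?addr0 // => q' /negbTE ->.
  by rewrite mul0r.
rewrite !sp (eq_bigr (fun j : 'I_N.+1 =>
    s j * (str_stop j == inl q)%:R - s j * (str_start j == inl q)%:R)); last first.
  by move=> j _; rewrite mulrBr.
rewrite sumrB (big_str_start _ (fun (j : 'I_N.+1) v => s j * (v == inl q)%:R)) /=.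
rewrite (big_str_stop _ (fun (j : 'I_N.+1) v => s j * (v == inl q)%:R)) /= !mulr0
    !add0r.
rewrite -sumrB (eq_bigr (fun i =>
    (i == lab q)%:R * - ((is_attach q)%:R * signed_tail_wt (lab q)))); last first.
  move=> i _; have -> : bump N i = i by rewrite /bump leqNgt ltn_ord.
  rewrite /bump /= add1n Hs is_attachE -/(signed_tail_wt i).
  have -> : (inl (att i) == inl q :> zvert) = (att i == q) by [].
  case: (eqVneq i (lab q)) => [->|h]; first by rewrite mulr1n; ring.
  case: eqP => [h'|_]; first by move: h; rewrite -h' labatt eqxx.
  by rewrite !mulr0n; ring.
rewrite (bigD1 (lab q)) //= eqxx mul1r big1 => [|i /negbTE ->]; last by rewrite mul0r.
by case: (is_attach q) => /=; lia.
Qed.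

Hypothesis HN : (1 < N)%N.
Hypothesis Hord : forall i j : 'I_N, j = i.+1 :> nat ->
  if 0 < s j then (att i < att j)%N else (att j < att i)%N.
Hypothesis Hy : forall q q' : 'I_t, (q < q')%N -> height q < height q'.

Lemma zphi_lt e : (zphi (zsrc e) < zphi (ztgt e))%E.
Proof.
rewrite /zsrc /ztgt; case: e => [x|j] /=.
  case: (posnP (chain_index (val x).1)) => h; last first.
    rewrite outer_endS //; have := outward_order h.
    by case: ifP => _ /=; rewrite lte_fin => /Hy.
  have [l -> hl] := outer_end0 (valP x) h; rewrite -hl /=.
  by case hl2: (lft (lab (sval l).1)); rewrite /= hl2 ?ltNyr ?ltry.
rewrite /str_start /str_stop; case: unliftP => [i hi|hi]; case: unliftP =>
    [i' hi'|hi'] /=.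
- have e1 : (j : nat) = i' by rewrite hi' lift_max.
  have e2 : (j : nat) = i.+1 by rewrite hi.
  have := @Hord i i'; rewrite -e1 e2 => /(_ (erefl _)).
  by case: ifP => _ /Hy; rewrite lte_fin.
- have -> : (j : nat) = N by rewrite hi'.
  by case h: (0 < s N); rewrite /= h ?ltry ?ltNyr.
- have -> : (j : nat) = 0%N by rewrite hi.
  by case h: (0 < s 0); rewrite /= h ?ltry ?ltNyr.
- by have := HN; have := congr1 val hi; rewrite hi' /= => ->.
Qed.

Lemma zslope e :
  (zphi (ztgt e) - zphi (zsrc e) = (zwt e)%:R%:E * zlen e)%E.
Proof.
rewrite /zlen muleA -EFinM mulfV ?mul1e //.
by rewrite pnatr_eq0 -lt0n zwt_gt0.
Qed.

Lemma zphi_inr w : zphi (inr w) = -oo%E \/ zphi (inr w) = +oo%E.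
Proof.
by case: w => [l|[]] /=; case: ifP; rewrite ?orbT; auto.
Qed.

Lemma zlen_pos (e : edge zgraph) : if is_end e then len e = +oo%E
  else exists2 l : R, 0 < l & len e = l%:E.
Proof.
have w0 : 0 < ((zwt e)%:R^-1 : R) by rewrite invr_gt0 ltr0n zwt_gt0.
have hv v : if v is inr _ then zphi v = -oo%E \/ zphi v = +oo%E
    else exists r, zphi v = r%:E.
  by case: v => [q|w]; [exists (height q) | apply: zphi_inr].
rewrite /is_end !zleafE /len /= /zlen.
have := zphi_lt e; have := hv (zsrc e); have := hv (ztgt e).
move: (zphi (zsrc e)) (zphi (ztgt e)) => a b.
case: (zsrc e) => [q|w]; case: (ztgt e) => [q'|w'] /=.
- move=> [b' ->] [a' ->]; rewrite lte_fin => h.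
  by exists ((zwt e)%:R^-1 * (b' - a')) => //; rewrite mulr_gt0 // subr_gt0.
- by move=> [] -> [a' ->] // _; rewrite gt0_muley ?lte_fin.
- by move=> [b' ->] [] -> // _; rewrite gt0_muley ?lte_fin.
- by move=> [] -> [] -> // _; rewrite gt0_muley ?lte_fin.
Qed.

Local Notation zcell := (cell zgraph).

(** The tail to which a cell belongs, [None] for cells of the string.  The tails
    will be the components of the complement of the string. *)
Definition tail_of (x : zcell) : option 'I_N :=
  match x with
  | inl (inl q) => if is_attach q then None else Some (lab q)
  | inl (inr (inl l)) => Some (lab (val l).1)
  | inl (inr (inr _)) => None
  | inr (inl x) => Some (lab (val x).1)
  | inr (inr _) => None
  end.

Lemma slot0_proof q : doubled (q, false).1 || ~~ (q, false).2.
Proof. by rewrite orbT. Qed.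
Definition slot0 q : slot := exist _ (q, false) (slot0_proof q).

Lemma incidentE (v : vert zgraph) (e : edge zgraph) :
  incident (inl v) (inr e) = (edge_start e == v) || (edge_stop e == v).
Proof. by rewrite /= /zsrc /ztgt; case: (rightward e) => //; rewrite orbC. Qed.

Section Connect.
Variable A : {set zcell}.

Lemma connect_incident v e : inl v \in A -> inr e \in A ->
    (edge_start e == v) || (edge_stop e == v) ->
  connect (adj_in A) (inl v) (inr e).
Proof. by move=> hv he h; apply: connect1; rewrite /adj_in hv he incidentE. Qed.

Lemma connect_adjC x y : connect (adj_in A) x y = connect (adj_in A) y x.
Proof. exact: (sym_connect_sym (@adj_in_sym _ _ A)). Qed.

Definition ord0N : 'I_N := Ordinal (ltnW HN).
Definition root : zcell := inl (inl (att ord0N)).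

Lemma str_start_pos (j : 'I_N.+1) (i : 'I_N) : (j : nat) = i.+1 ->
    str_start j = inl (att i).
Proof. by move=> h; rewrite -str_startS; congr str_start; apply: val_inj. Qed.

Lemma str_stop_val (j : 'I_N.+1) (i : 'I_N) : (j : nat) = i -> str_stop j = inl (att i).
Proof. by move=> h; rewrite -str_stopS; congr str_stop; apply: val_inj;
  rewrite /= h /bump leqNgt ltn_ord. Qed.

(** Moving backwards along the string reaches the attachment of tail 0. *)
Lemma connect_string : (forall x, tail_of x = None -> x \in A) ->
  forall x, tail_of x = None -> connect (adj_in A) x root.
Proof.
move=> hA.
have hatt i : inl (inl (att i)) \in A by apply: hA; rewrite /= is_attach_att.
have hj j : inr (inr j) \in A by apply: hA.
have catt (i : 'I_N) : connect (adj_in A) (inl (inl (att i))) root.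
  case: i => i; elim: i => [|i IH] hi.
    by have -> : Ordinal hi = ord0N by apply: val_inj.
  apply: connect_trans (IH (ltnW hi)).
  have hi' : (i.+1 < N.+1)%N by rewrite ltnW.
  apply: (@connect_trans _ _ (inr (inr (Ordinal hi')))).
    by apply: connect_incident; rewrite //= (@str_stop_val _ (Ordinal hi)) // eqxx orbT.
  by rewrite connect_adjC; apply: connect_incident;
      rewrite //= (@str_start_pos _ (Ordinal (ltnW hi))) // eqxx.
have cj j : connect (adj_in A) (inr (inr j)) root.
  case: (unliftP ord_max j) => [i hi|hi].
    apply: connect_trans (catt i); rewrite connect_adjC.
    by apply: connect_incident; rewrite //= hi str_stopS eqxx orbT.
  have hN : (N.-1 < N)%N by rewrite prednK // ltnW.
  apply: connect_trans (catt (Ordinal hN)); rewrite connect_adjC.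
  apply: connect_incident; rewrite //= (@str_start_pos _ (Ordinal hN)) ?eqxx //= hi /=.
  by rewrite prednK // ltnW.
case=> [[q|[l|b]]|[x|j]] //=.
- by case: (boolP (is_attach q)) => //; rewrite is_attachE => /eqP <- _.
- move=> _; apply: connect_trans (cj (if b then ord_max else ord0)).
  apply: connect_incident => //; first by apply: hA.
  by case: b => /=; rewrite ?str_start0 ?str_stop_max eqxx ?orbT.
Qed.

(** Moving inwards reaches the edge by which the tail is attached. *)
Lemma connect_tail i : (forall x, tail_of x = Some i -> x \in A) ->
  forall x, tail_of x = Some i -> connect (adj_in A) x (inr (inl (slot0 (att i)))).
Proof.
move=> hA.
have cx n (x : slot) : (size (chain i) - chain_index (val x).1 <= n)%N ->
    lab (val x).1 = i ->
    connect (adj_in A) (inr (inl x)) (inr (inl (slot0 (att i)))).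
  elim: n x => [|n IH] x hn hx.
    by move: (chain_index_lt (val x).1); rewrite hx; move: hn;
        rewrite leqn0 subn_eq0 leqNgt => /negbTE ->.
  case: (boolP (is_attach (val x).1)) => h.
    have -> : x = slot0 (att i) :> slot.
      apply: val_inj; case: x hx h {hn} => -[q b] /= hb <- h.
      move: (hb); rewrite /= doubled_attach //= => /negbTE ->.
      by move: h; rewrite is_attachE => /eqP ->.
    exact: connect0.
  apply: (@connect_trans _ _ (inl (inl (val x).1))).
    rewrite connect_adjC; apply: connect_incident; rewrite ?hA //= ?hx ?(negbTE h) //.
    by rewrite eqxx orbT.
  apply: (@connect_trans _ _ (inr (inl (slot0 (inward (val x).1))))).
    apply: connect_incident; rewrite ?hA //= ?hx ?(negbTE h) ?lab_inward ?hx //.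
    by rewrite outer_endS /= ?chain_index_inward // inwardK // eqxx.
  apply: IH; rewrite /= ?lab_inward // chain_index_inward // subnS.
  by move: hn; case: (_ - _)%N.
case=> [[q|[l|b]]|[x|j]] //=.
- case: (boolP (is_attach q)) => // h [hq].
  apply: connect_trans (cx _ (slot0 (inward q)) (leqnn _) _);
      last by rewrite /= lab_inward.
  apply: connect_incident; rewrite ?hA //= ?(negbTE h) ?lab_inward ?hq //.
  by rewrite outer_endS /= ?chain_index_inward // inwardK // eqxx.
- move=> [hl]; have [_ h2] := andP (valP l).
  pose x : slot := exist _ (val l) h2.
  apply: connect_trans (cx _ x (leqnn _) _); last by rewrite /= hl.
  by apply: connect_incident; rewrite ?hA //= ?hl // outer_end_leaf eqxx.
- by move=> [hx]; apply: (cx _ _ (leqnn _)).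
Qed.

End Connect.

Lemma zconnected : connected_cells [set: zcell].
Proof.
split; first by apply/set0Pn; exists root; rewrite inE.
have h x : connect (adj_in [set: zcell]) x root.
  case hx: (tail_of x) => [i|]; last by apply: connect_string => // *; rewrite inE.
  apply: (connect_trans (connect_tail _ hx)) => [*|]; first by rewrite inE.
  apply: (@connect_trans _ _ (inl (inl (att i)))).
    by rewrite connect_adjC; apply: connect_incident; rewrite ?inE //= eqxx orbT.
  by apply: connect_string => [*|]; rewrite ?inE //= is_attach_att.
by move=> x y _ _; apply: (connect_trans (h x)); rewrite connect_adjC.
Qed.

Lemma ztropical_curve : tropical_curve zgraph.
Proof.
split; first exact: zconnected.
- by case=> [q|w]; rewrite ?inner_inl ?leaf_inr ?orbT.
- exact: zlen_pos.
Qed.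

Definition end_wt i : nat := if frk i then kk i else (2 * kk i)%N.
Definition tail_ends (b : bool) : seq nat :=
  flatten [seq nseq (1 + frk i) (end_wt i) | i <- enum 'I_N & lft i == b].
Definition ends (b : bool) : seq nat :=
  tail_ends b ++ (if (0 < s 0) == b then [:: `|s 0|%N] else [::]) ++
    (if (0 < s N) == b then [::] else [:: `|s N|%N]).

Definition at_infinity (b : bool) e : bool :=
  if b then zphi (zsrc e) == -oo%E else zphi (ztgt e) == +oo%E.

Lemma at_infinity_slot b x :
  at_infinity b (inl x) = (chain_index (val x).1 == 0%N) && (lft (lab (val x).1) == b).
Proof.
rewrite /at_infinity /zsrc /ztgt /=; case: (posnP (chain_index (val x).1)) => h;
    last first.
  by rewrite outer_endS //; case: b; case: ifP.
have [l -> hl] := outer_end0 (valP x) h; rewrite -hl /=.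
by case: b; case hb: (lft (lab (sval l).1)); rewrite /= ?hb ?eqxx.
Qed.

Lemma at_infinity_str b (j : 'I_N.+1) :
  at_infinity b (inr j) = ((j == ord0) && ((0 < s j) == b))
      || ((j == ord_max) && ((0 < s j) != b)).
Proof.
rewrite /at_infinity /zsrc /ztgt /= /str_start /str_stop.
case: unliftP => [i hi|hi]; case: unliftP => [i' hi'|hi'].
- have -> : (j == ord0) = false by rewrite hi.
  have -> : (j == ord_max) = false by rewrite hi' eq_sym (negbTE (neq_lift _ _)).
  by case: b; case: ifP.
- have -> : (j == ord0) = false by rewrite hi.
  rewrite hi' eqxx /=; case: b; case h: (0 < s N); by rewrite /= ?h ?eqxx.
- have -> : (j == ord_max) = false by rewrite hi' eq_sym (negbTE (neq_lift _ _)).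
  rewrite hi eqxx /= orbF; case: b; case h: (0 < s 0); by rewrite /= ?h ?eqxx.
- by have := HN; have := congr1 val hi; rewrite hi' /= => ->.
Qed.

Lemma sum_heads (G : 'I_N -> nat) :
  (\sum_q (chain_index q == 0%N) * G (lab q) = \sum_i G i)%N.
Proof.
rewrite (partition_big lab predT) //=; apply: eq_bigr => i _.
have hi : (0 < size (chain i))%N.
  by have := is_attach_att i; rewrite /is_attach labatt => /eqP <-.
have h0 := lab_nth_chain (att i) hi; have r0 := chain_index_nth (att i) hi.
rewrite (bigD1 (nth (att i) (chain i) 0)) /= ?h0 // r0 mul1n big1 ?addn0 //.
move=> q /andP[/eqP hq hne]; case: eqP => // h.
by case/eqP: hne; apply: lab_chain_index_inj; rewrite ?h0 ?r0.
Qed.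

(** Both sides count the same multiset: a tail contributes the outer side of the
    first vertex of its chain, the string its first and last edges. *)
Lemma ends_perm b :
  perm_eq [seq zwt e | e <- enum zedge & at_infinity b e] (ends b).
Proof.
apply/seq.permP => P; rewrite count_map count_filter -sum1_count big_enum_cond /=.
rewrite big_mkcond /= (@big_edges _ _ _
  (fun x => (chain_index x.1 == 0%N) * ((lft (lab x.1) == b) * P (end_wt (lab x.1))))%N
  (fun j : 'I_N.+1 => (j == ord0) * (((0 < s j)%R == b) * P `|s j|%N) +
             (j == ord_max) * (((0 < s j)%R != b) * P `|s j|%N))%N); first last.
- move=> j; rewrite at_infinity_str /=.
  case: (eqVneq j ord0) => [->|_]; case: (eqVneq _ ord_max) => [h|_];
    rewrite ?mul1n ?mul0n /= ?orbF ?andbF //.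
  + by have := HN; have := congr1 val h => /= <-.
  + by case: (_ == b); case: (P _).
  + by case: (_ == b); case: (P _).
- move=> x; rewrite at_infinity_slot /= /end_wt /outer_wt /doubled.
  by case: eqP => [->|_]; rewrite /= ?addbF ?andbF // ?mul1n; case: (_ == b);
      case: (P _).
rewrite (eq_bigr (fun q => (chain_index q == 0%N) * ((1 + frk (lab q)) *
    ((lft (lab q) == b) * P (end_wt (lab q)))))%N); last first.
  move=> q _ /=; rewrite /doubled; case: eqP => [->|_]; last by case: ifP.
  by rewrite addbF !mul1n; case: (frk _); rewrite ?mul1n ?addn0 // addn1 mul2n addnn.
rewrite (sum_heads (fun i => (1 + frk i) * ((lft i == b) * P (end_wt i)))%N).
rewrite -[LHS]/(addn _ _) [X in (_ + X)%N]big_split !sum_pred1 /ends !count_cat;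
    congr addn.
  rewrite /tail_ends count_flatten -map_comp sumnE big_map big_filter big_enum_cond /=.
  rewrite [RHS]big_mkcond; apply: eq_bigr => i _ /=.
  by rewrite count_nseq; case: (_ == b);
      rewrite ?mul0n ?muln0 // ?mul1n mulnDl mul1n mulnC.
by case: (_ == b); case: (_ == b); rewrite /= ?mul1n ?mul0n ?addn0 ?add0n.
Qed.

(** The genus needs no count of cycles: by [trivalent_betti1] it is determined by
    the number of inner vertices and the number of leaves. *)
Lemma zcover_tropical (g : nat) (la mu : seq nat) (y : seq R) :
  perm_eq (ends true) la -> perm_eq (ends false) mu ->
  (forall r, (r \in y) = [exists q, height q == r]) ->
  (t + 2 = size la + size mu + 2 * g)%N ->
  tropical_cover g la mu y zcover.
Proof.
move=> hla hmu hyv ht.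
have h0 : tropical_cover (betti1 zgraph) la mu y zcover.
  split.
  - by split=> //; apply: ztropical_curve.
  - split; last by case=> [q|w]; rewrite ?zleafE // => _; apply: zphi_inr.
    apply/seteqP; split=> [_ [v + <-]|_ [r + <-]] /=.
      rewrite /= zinnerE; case: v => // q _; exists (height q) => //.
      have : height q \in y by rewrite hyv; apply/existsP; exists q.
      by [].
    move=> hr; have : r \in y by [].
    by rewrite hyv => /existsP[q /eqP <-]; exists (inl q) => //=; exact: inner_inl.
  - by move=> e; split; [exact: zwt_gt0 | exact: zslope].
  - by case=> [q|w]; rewrite zinnerE // => _; apply: balance.
  - split; [apply: perm_trans hla | apply: perm_trans hmu];
      [exact: (ends_perm true) | exact: (ends_perm false)].
have [h1 h2 h3 h4 h5] := h0; split=> //; split; first by case: h1.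
have [_] := trivalent_betti1 ztropical_curve; apply.
rewrite (card_leaves h0); suff -> : #|[pred v : vert zgraph | is_inner v]| = t by [].
rewrite -sum1_card big_sumType /= [X in (_ + X)%N]big1 ?addn0; last first.
  by move=> w; rewrite inE zinnerE.
rewrite (eq_bigl xpredT) ?sum1_card ?card_ord // => q.
by rewrite inE zinnerE.
Qed.

Hypothesis Hodd : forall i, (1 + frk i < size (chain i))%N -> odd (kk i).

Definition string_cells : {set zcell} := [set x | tail_of x == None].

Lemma joinsE (e : edge zgraph) u v : joins e u v =
  ((edge_start e == u) && (edge_stop e == v))
      || ((edge_start e == v) && (edge_stop e == u)).
Proof.
rewrite /joins /= /zsrc /ztgt; case: (rightward e) => //.
by rewrite orbC andbC [X in _ || X]andbC.
Qed.

Definition slot1 q (h : doubled q) : slot :=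
    @exist _ (fun x => doubled x.1 || ~~ x.2) (q, true) (introT orP (or_introl h)).

(** What tail [i] consists of outside its [r]-th vertex: the intermediate stages
    in the inductive construction of the tail. *)
Definition tail_cells i r : {set zcell} := [set x | match x with
  | inl (inl q) => (lab q == i) && (chain_index q < r)%N
  | inl (inr (inl l)) => lab (val l).1 == i
  | inl (inr (inr _)) => false
  | inr (inl x) => (lab (val x).1 == i) && (chain_index (val x).1 <= r)%N
  | inr (inr _) => false
  end].

Definition chain_at i r := nth (att i) (chain i) r.

Lemma chain_atP i r q : (r < size (chain i))%N -> (lab q == i) &&
    (chain_index q == r) = (q == chain_at i r).
Proof.
move=> h; apply/andP/eqP => [[/eqP <- /eqP <-]|->];
    first by rewrite /chain_at nth_chain_index.
by rewrite lab_nth_chain // chain_index_nth.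
Qed.

Lemma pair_single (x : 'I_t * bool) q : doubled x.1 || ~~ x.2 -> doubled q = false ->
  (x.1 == q) = (x == (q, false)).
Proof.
case: x => q' b /= h hq; rewrite xpair_eqE; case: (eqVneq q' q) => //= e.
by move: h; rewrite e hq; case: b.
Qed.

Lemma pair_double (x : 'I_t * bool) q :
  (x.1 == q) = (x == (q, false)) || (x == (q, true)).
Proof. by case: x => q' b; rewrite !xpair_eqE /=; case: b; case: (_ == _). Qed.

Lemma lab_chain_at i r : (r < size (chain i))%N -> lab (chain_at i r) = i.
Proof. by move=> h; rewrite /chain_at lab_nth_chain. Qed.

Lemma chain_index_at i r : (r < size (chain i))%N -> chain_index (chain_at i r) = r.
Proof. by move=> h; rewrite /chain_at chain_index_nth. Qed.

Lemma outward_at i r : (r.+1 < size (chain i))%N ->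
    outward (chain_at i r.+1) = chain_at i r.
Proof.
by move=> h; apply: lab_chain_index_inj;
    rewrite ?lab_outward ?chain_index_outward ?lab_chain_at ?chain_index_at //;
    apply: ltnW.
Qed.

Lemma outer_end_at i r b : (r.+1 < size (chain i))%N ->
  outer_end (chain_at i r.+1, b) = inl (chain_at i r).
Proof. by move=> h; rewrite outer_endS ?outward_at //= chain_index_at. Qed.

Lemma slot_cell (x x' : slot) : (inr (inl x) == inr (inl x') :> zcell)
    = (val x == val x').
Proof. by []. Qed.

Lemma leaf_cell (x x' : leafslot) :
  (inl (inr (inl x)) == inl (inr (inl x')) :> zcell) = (val x == val x').
Proof. by []. Qed.

Lemma inner_cell q q' : (inl (inl q) == inl (inl q') :> zcell) = (q == q').
Proof. by []. Qed.

Lemma slot0_neq_slot1 q (h : doubled q) : inl (slot0 q) != inl (slot1 h) :> zedge.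
Proof.
by apply/eqP => /(congr1 (fun e : zedge => if e is inl x then (val x).2 else true)).
Qed.

Lemma zend_slot x : @is_end R zgraph (inl x) = (chain_index (val x).1 == 0%N).
Proof.
rewrite /is_end !zleafE /= /zsrc /ztgt /=; case: (posnP (chain_index (val x).1)) => h.
  by have [l -> _] := outer_end0 (valP x) h; case: (lft _).
by rewrite outer_endS //; case: (lft _).
Qed.

Lemma tail_base_end i : frk i = false ->
  tail (c := zcover) (kk i) (tail_cells i 0) (inl (chain_at i 0)).
Proof.
move=> hf.
have h0 : (0 < size (chain i))%N by have := Hpar i; rewrite hf; case: (size _).
have hl := lab_chain_at h0; have hr := chain_index_at h0.
have hd : doubled (chain_at i 0) = false by rewrite /doubled hl hf hr.
have [l hol hl'] := @outer_end0 (chain_at i 0, false) (slot0_proof _) hr.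
have -> : tail_cells i 0 = [set inl (inr (inl l)); inr (inl (slot0 (chain_at i 0)))].
  apply/setP => z; rewrite finset.in_set2 finset.in_set; case: z => [[q'|[l'|b]]|[x|j]];
    rewrite ?ltn0 ?andbF ?slot_cell ?leaf_cell //.
  - have [/eqP h1 h2] := andP (valP l'); rewrite hl' -pair_single // -chain_atP //.
    by rewrite h1 eqxx andbT orbF.
  - by rewrite -pair_single // ?(valP x) // -chain_atP // leqn0.
apply: tail_end; first exact: leaf_inr.
- by rewrite joinsE /= hol !eqxx.
- by rewrite /= /outer_wt /= hd hl.
Qed.

Lemma tail_base_fork i : frk i -> (1 < size (chain i))%N ->
  tail (c := zcover) (kk i) (tail_cells i 1) (inl (chain_at i 1)).
Proof.
move=> hf h1; have h0 := ltnW h1.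
have hl0 := lab_chain_at h0; have hr0 := chain_index_at h0.
have hl1 := lab_chain_at h1; have hr1 := chain_index_at h1.
have hd0 : doubled (chain_at i 0) by rewrite /doubled hl0 hf hr0.
have hd1 : doubled (chain_at i 1) = false by rewrite /doubled hl1 hf hr1.
have [l hol hl] := @outer_end0 (chain_at i 0, false) (slot0_proof _) hr0.
have [l' hol' hl'] := @outer_end0 (chain_at i 0, true) (valP (slot1 hd0)) hr0.
have -> : tail_cells i 1 = [set inl (inl (chain_at i 0)); inl (inr (inl l));
    inl (inr (inl l'));
    inr (inl (slot0 (chain_at i 0))); inr (inl (slot1 hd0));
        inr (inl (slot0 (chain_at i 1)))].
  apply/setP => z; rewrite !finset.in_setU !finset.in_set1 finset.in_set; case: z =>
      [[q'|[m|b]]|[x|j]];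
    rewrite ?slot_cell ?leaf_cell ?inner_cell ?orbF //.
  - by rewrite ltnS leqn0 chain_atP.
  - have [/eqP h _] := andP (valP m); rewrite hl hl' -pair_double -chain_atP //.
    by rewrite h eqxx andbT.
  - rewrite leq_eqVlt ltnS leqn0 andb_orr !chain_atP // orbC pair_double.
    by rewrite (pair_single (valP x)).
apply: (@tail_fork _ zcover _ _ _ _ _ (inr (inl l)) (inr (inl l'))).
- split; rewrite ?slot0_neq_slot1 ?zend_slot /= ?hr0 //.
  exists (inl (chain_at i 0)), (inr (inl l)), (inr (inl l')).
  by split; rewrite ?inner_inl // joinsE /= ?hol ?hol' !eqxx !orbT.
- by rewrite /= /outer_wt /= hd0 hl0.
- exact: leaf_inr.
- by rewrite joinsE /= hol !eqxx orbT.
- exact: leaf_inr.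
- by rewrite joinsE /= hol' !eqxx orbT.
- by rewrite joinsE /= outer_end_at // !eqxx.
- by rewrite /= /outer_wt /= hd1 hl1.
Qed.

Lemma tail_step i r : (r.+2 < size (chain i))%N -> doubled (chain_at i r) = false ->
    odd (kk i) ->
  tail (c := zcover) (kk i) (tail_cells i r) (inl (chain_at i r)) ->
  tail (c := zcover) (kk i) (tail_cells i r.+2) (inl (chain_at i r.+2)).
Proof.
move=> h2 hd0 hk IH; have h1 := ltnW h2; have h0 := ltnW h1.
have hl0 := lab_chain_at h0; have hr0 := chain_index_at h0.
have hl1 := lab_chain_at h1; have hr1 := chain_index_at h1.
have hl2 := lab_chain_at h2; have hr2 := chain_index_at h2.
have hd1 : doubled (chain_at i r.+1).
  by move: hd0; rewrite /doubled hl0 hl1 hr0 hr1 /= addbN => ->.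
have hd2 : doubled (chain_at i r.+2) = false.
  by move: hd0; rewrite /doubled hl0 hl2 hr0 hr2 /= negbK => ->.
have -> : tail_cells i r.+2 = tail_cells i r :|: [set inl (inl (chain_at i r));
    inl (inl (chain_at i r.+1)); inr (inl (slot0 (chain_at i r.+1)));
        inr (inl (slot1 hd1));
    inr (inl (slot0 (chain_at i r.+2)))].
  apply/setP => z; rewrite !finset.in_setU !finset.in_set1 !finset.in_set; case: z =>
      [[q'|[m|b]]|[x|j]];
    rewrite ?slot_cell ?leaf_cell ?inner_cell ?orbF //.
  - by rewrite -!chain_atP //; case: (lab q' == i) => //=; lia.
  - have -> (q : 'I_t) : (inr (inl x) == inl (inl q) :> zcell) = false by [].
    rewrite !orFb -(pair_single (valP x) hd2) -pair_double -!chain_atP //.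
    by case: (_ == i) => //=; lia.
apply: (@tail_cycle _ zcover _ _ _ _ _ (inl (chain_at i r))) => //.
- split; rewrite ?slot0_neq_slot1 ?zend_slot /= ?hr1 //.
  rewrite joinsE /= /zsrc /ztgt /= !outer_end_at //; case: (lft _);
      by rewrite !eqxx ?orbT.
- by rewrite /= /outer_wt /= hd1 hl1.
- by rewrite joinsE /= outer_end_at // !eqxx.
- by rewrite joinsE /= outer_end_at // !eqxx.
- by rewrite joinsE /= outer_end_at // !eqxx.
- by rewrite /= /outer_wt /= hd2 hl2.
Qed.

(** The vertices of a chain whose outer side is single are those where a stage of
    the construction ends; each further cycle uses two vertices. *)
Lemma tail_chain i n : (n.*2 + frk i < size (chain i))%N ->
  tail (c := zcover) (kk i) (tail_cells i (n.*2 + frk i))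
      (inl (chain_at i (n.*2 + frk i))).
Proof.
elim: n => [|n IH] h.
  rewrite add0n in h *; case hf: (frk i) h => h; last exact: tail_base_end.
  exact: tail_base_fork.
rewrite doubleS !addSn in h *; have h0 := ltnW (ltnW h).
apply: tail_step => //; last exact: IH.
  by rewrite /doubled lab_chain_at // chain_index_at // oddD odd_double; case: (frk i).
by apply: Hodd; lia.
Qed.

Lemma tail_full i :
  tail (c := zcover) (kk i) [set x | tail_of x == Some i] (inl (att i)).
Proof.
have hsz : (chain_index (att i)).+1 = size (chain i).
  by have := is_attach_att i; rewrite /is_attach labatt => /eqP.
have hrk : chain_index (att i) = ((chain_index (att i))./2.*2 + frk i)%N.
  rewrite -[LHS]odd_double_half addnC; congr addn; congr nat_of_bool.
  by have := Hpar i; rewrite -hsz /=; case: (frk i); case: (odd _).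
have hlt : ((chain_index (att i))./2.*2 + frk i < size (chain i))%N by rewrite -hrk
    -hsz.
have := tail_chain hlt; rewrite -hrk.
have -> : chain_at i (chain_index (att i)) = att i.
  by apply: lab_chain_index_inj; rewrite ?lab_chain_at ?chain_index_at // -hsz.
congr tail; apply/setP => z; rewrite !finset.in_set; case: z => [[q'|[m|b]]|[x|j]] //=.
- rewrite is_attachE; case: (eqVneq (lab q') i) => [e|ne] /=.
    have := chain_index_lt q'; rewrite e -hsz ltnS leq_eqVlt.
    have -> : (chain_index q' == chain_index (att i)) = (att i == q').
      apply/eqP/eqP => [h|<- //]; apply: lab_chain_index_inj; by rewrite ?labatt.
    by case: eqP => [<-|_] /=; rewrite ?ltnn // => ->; rewrite eqxx.
  by case: ifP => //; rewrite -(inj_eq (@Some_inj _)) => _; apply/esym/negbTE.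
rewrite -[RHS]/(lab (sval x).1 == i); case: eqP => //= e.
by have := chain_index_lt (sval x).1; rewrite e -hsz ltnS => ->.
Qed.

(** Tails meet only along the string. *)
Lemma incident_tail_of (a b : zcell) : tail_of a != None -> tail_of b != None ->
  incident a b -> tail_of a = tail_of b.
Proof.
have main v e : tail_of (inl v) != None -> tail_of (inr e) != None ->
    incident (inl v) (inr e) -> tail_of (inl v) = tail_of (inr e).
  rewrite incidentE; case: e => [x|j] //; case: v => [q|[l|bb]] //=.
    case: (boolP (is_attach q)) => // hq _ _; rewrite (outer_end_eq_inl _ (valP x)).
    case/orP => [/andP[_ /eqP ->]|/eqP [->] //].
    by rewrite lab_inward.
  by move=> _ _; rewrite outer_end_eq_leaf orbF => /eqP ->.
case: a b => [v|e] [v'|e'] // h1 h2 h3; first exact: main.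
by apply/esym/main.
Qed.

Lemma component_tail x i : tail_of x = Some i ->
  component (~: string_cells) x = [set z | tail_of z == Some i].
Proof.
move=> hx; apply/setP => z; rewrite !finset.in_set.
have hA z' : tail_of z' = Some i -> z' \in ~: string_cells by move=> h; rewrite !inE h.
apply/andP/eqP => [[_ /connectP[p]]|hz].
  elim: p x hx => [|x' p IH] x hx /= ; first by move=> _ ->.
  move=> /andP[/and3P[h1 h2 h3] hp] hz; apply: (IH x') => //.
  by rewrite -hx; apply/esym/incident_tail_of; move: h1 h2; rewrite // !inE.
split; first by rewrite hz.
by apply: connect_trans (connect_tail hA hx) _; rewrite connect_adjC;
    apply: connect_tail.
Qed.

Lemma att_inj : injective att.
Proof. exact: can_inj labatt. Qed.

Lemma str_start_att (j : 'I_N.+1) i : str_start j = inl (att i) -> (j : nat) = i.+1.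
Proof.
by rewrite /str_start; case: unliftP => // i' -> [/att_inj ->].
Qed.

Lemma str_stop_att (j : 'I_N.+1) i : str_stop j = inl (att i) -> (j : nat) = i.
Proof.
rewrite /str_stop; case: unliftP => // i' -> [/att_inj ->].
by rewrite /= /bump leqNgt ltn_ord.
Qed.

Lemma str_attach (j : 'I_N.+1) q : (str_start j == inl q) || (str_stop j == inl q) ->
    is_attach q.
Proof.
rewrite /str_start /str_stop; case: unliftP => [i _|_]; case: unliftP => [i' _|_] //=;
  rewrite ?orbF; try case/orP; by move=> /eqP[<-].
Qed.

Lemma zend_str j : @is_end R zgraph (inr j) = (j == ord0) || (j == ord_max).
Proof.
rewrite /is_end !zleafE /= /zsrc /ztgt /= /str_start /str_stop.
case: unliftP => [i hi|hi]; case: unliftP => [i' hi'|hi'].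
- have -> : (j == ord0) = false by rewrite hi.
  have -> : (j == ord_max) = false by rewrite hi' eq_sym (negbTE (neq_lift _ _)).
  by case: ifP.
- by rewrite hi' eqxx orbT; case: ifP.
- by rewrite hi eqxx; case: ifP.
- by rewrite hi eqxx; case: ifP.
Qed.

(** The endpoints of an inner string edge belong to different tails, and only one
    string edge joins them. *)
Lemma str_no_cycle j e' : ~ symmetric_cycle (c := zcover) (inr j) e'.
Proof.
case=> hne; rewrite zend_str => hj _ _ hjoin.
have {}hjoin : @joins R zgraph e' (str_start j) (str_stop j).
  move: hjoin; rewrite /= /zsrc /ztgt /=; case: ifP => _ //.
  by rewrite joinsC.
move: hj hjoin; rewrite negb_or joinsE => /andP[hj0 hjN].
have [i hi eA'] : exists2 i : 'I_N, (j : nat) = i.+1 & str_start j = inl (att i).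
  move: hj0; rewrite /str_start; case: unliftP => [i -> _|->]; last by rewrite eqxx.
  by exists i.
have [i' hi' eB'] : exists2 i : 'I_N, (j : nat) = i & str_stop j = inl (att i).
  move: hjN; rewrite /str_stop; case: unliftP => [i'' -> _|->]; last by rewrite eqxx.
  by exists i'' => //=; rewrite /bump leqNgt ltn_ord.
rewrite eA' eB'; case: e' hne => [x|j'] hne /=.
  rewrite !(inj_eq (@inl_inj _ _)) !(outer_end_eq_inl _ (valP x)) !is_attach_att /=.
  by [].
case/orP => /andP[/eqP h1 /eqP h2].
  case/eqP: hne; congr inr; apply: val_inj => /=.
  by rewrite (str_stop_att h2).
have := str_start_att h1; have := str_stop_att h2; lia.
Qed.

(** The two ends of the string are at different vertices, and an end of a tail
    that is adjacent to the string has even weight. *)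
Lemma str_no_fork j e' : ~ symmetric_fork (c := zcover) (inr j) e'.
Proof.
case=> hne; rewrite zend_str => hj he' hwt [v [l [l' [hv]]]].
move: hv; rewrite zinnerE; case: v => // q _; rewrite !joinsE => h1 h2.
have side (e : zedge) w : (edge_start e == inl q) &&
    (edge_stop e == w) || (edge_start e == w) && (edge_stop e == inl q) ->
    (edge_start e == inl q) || (edge_stop e == inl q).
  by case/orP => /andP[h3 h4]; rewrite ?h3 ?h4 ?orbT.
have {}h1 := side _ _ h1; have {}h2 := side _ _ h2.
have hq : is_attach q by apply: (str_attach h1).
case: e' hne he' hwt h2 => [x|j'] hne.
  rewrite zend_slot => /eqP h0; have [k hk _] := outer_end0 (valP x) h0.
  move=> hwt; rewrite /= in hk; rewrite /= hk /= => /eqP[hx].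
  move: hwt; rewrite /= /outer_wt hx doubled_attach // => hwt.
  by have := odd_s j; rewrite hwt oddM.
rewrite zend_str => hj' _ h2.
have ends0 (a : 'I_N.+1) : a == ord0 ->
    (edge_start (inr a) == inl q) || (edge_stop (inr a) == inl q) ->
    (lab q : nat) = 0%N.
  move=> /eqP ->; rewrite /= str_start0 /= => /eqP h.
  have : str_stop ord0 = inl (att (lab q)) by rewrite h; congr inl; apply/esym/eqP;
      rewrite -is_attachE.
  by move/str_stop_att => <-.
have endsN (a : 'I_N.+1) : a == ord_max ->
    (edge_start (inr a) == inl q) || (edge_stop (inr a) == inl q) ->
    N = (lab q).+1 :> nat.
  move=> /eqP ->; rewrite /= str_stop_max orbF => /eqP h.
  have : str_start ord_max = inl (att (lab q)) by rewrite h; congr inl;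
      apply/esym/eqP; rewrite -is_attachE.
  by move/str_start_att => <-.
have hcon : (lab q : nat) = 0%N -> N = (lab q).+1 :> nat -> False.
  by move=> h3 h4; have := HN; rewrite h4 h3.
case/orP: hj => hj; case/orP: hj' => hj'.
- by case/eqP: hne; rewrite (eqP hj) (eqP hj').
- exact: hcon (ends0 _ hj h1) (endsN _ hj' h2).
- exact: hcon (ends0 _ hj' h2) (endsN _ hj h1).
- by case/eqP: hne; rewrite (eqP hj) (eqP hj').
Qed.

Lemma zcover_zigzag : zigzag zcover.
Proof.
exists string_cells.
have hS x : (x \in string_cells) = (tail_of x == None) by rewrite inE.
split.
- split.
    move=> [x|j]; rewrite !hS // => _.
    rewrite /= /zsrc /ztgt /= /str_start /str_stop.
    by case: unliftP => [i _|_]; case: unliftP => [i' _|_]; case: ifP;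
      rewrite /= ?is_attach_att.
  split; first by apply/set0Pn; exists root; rewrite hS /= is_attach_att.
  move=> x y; rewrite !hS => /eqP hx /eqP hy.
  have hA z : tail_of z = None -> z \in string_cells by rewrite hS => ->.
  by apply: connect_trans (connect_string hA hx) _; rewrite connect_adjC;
      apply: connect_string.
- by exists (inl (att ord0N)); rewrite ?inner_inl // hS /= is_attach_att.
- by move=> [x|j]; rewrite hS //= odd_s.
- move=> [x|j]; rewrite hS // => _ e'.
  by split; [apply: str_no_cycle | apply: str_no_fork].
- move=> x; rewrite !inE => hx; case ht: (tail_of x) hx => [i|] // _.
  exists (kk i), (inl (att i)); rewrite hS /= is_attach_att; split=> //.
  by rewrite (component_tail ht); apply: tail_full.
Qed.

(** How the inner vertices are joined: along a tail, or by an edge of odd weight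
    between consecutive attachments.  Only the latter case has odd weight at an
    attachment, which is what makes the cover determine its layout. *)
Lemma joins_inl (e : edge zgraph) q q' : joins e (inl q) (inl q') ->
  [\/ [/\ ~~ is_attach q, q' = inward q & zwt e = outer_wt q'],
      [/\ ~~ is_attach q', q = inward q' & zwt e = outer_wt q]
    | [/\ is_attach q, is_attach q', odd (zwt e) &
        (lab q' : nat) = (lab q).+1 \/ (lab q : nat) = (lab q').+1]].
Proof.
rewrite joinsE; case: e => [x|j] /=.
  rewrite !(inj_eq (@inl_inj _ _)) !(outer_end_eq_inl _ (valP x)).
  case/orP => /andP[/andP[h1 /eqP h2] /eqP h3].
    by constructor 1; rewrite -h3 -h2.
  by constructor 2; rewrite -h3 -h2.
move=> h; have [hq hq'] : is_attach q /\ is_attach q'.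
  by case/orP: h => /andP[h1 h2]; split; apply: (@str_attach j); rewrite ?h1 ?h2 ?orbT.
constructor 3; split=> //; first exact: odd_s.
move: (hq) (hq'); rewrite !is_attachE => /eqP eq /eqP eq'.
rewrite -eq -eq' !labatt in h *.
case/orP: h => /andP[/eqP/str_start_att h1 /eqP/str_stop_att h2]; [left|right]; lia.
Qed.

Lemma edge_inward q : ~~ is_attach q ->
  exists2 e : edge zgraph, joins e (inl q) (inl (inward q)) &
      zwt e = outer_wt (inward q).
Proof.
move=> h; exists (inl (slot0 (inward q))) => //.
by rewrite joinsE /= outer_endS /= ?chain_index_inward // inwardK // !eqxx.
Qed.

Lemma edge_str (i i' : 'I_N) : (i' : nat) = i.+1 ->
  exists2 e : edge zgraph, joins e (inl (att i)) (inl (att i')) & odd (zwt e).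
Proof.
move=> h; have hi : (i' < N.+1)%N by apply: ltnW; apply: ltn_ord.
exists (inr (Ordinal hi)); last exact: odd_s.
by rewrite joinsE /= (@str_start_pos _ i) // (@str_stop_val _ i') // !eqxx.
Qed.

Lemma outer_wt_attach q : is_attach q -> odd (outer_wt q) = false.
Proof. by move=> /doubled_attach h; rewrite /outer_wt h oddM. Qed.

End Chains.
End Construction.

(** The data shared by all covers in the family: tails in the order of their
    attachment, and the signed weights of the string. *)
Record string_data (N : nat) (lft : 'I_N -> bool) (kk : 'I_N -> nat) (s : nat -> int)
    : Prop :=
  StringData {
    string_size : (1 < N)%N;
    tail_wt : forall i, (0 < kk i)%N;
    string_odd : odd `|s 0|;
    string_step : forall i : 'I_N,
      s i.+1 = s i + (if lft i then (2 * kk i)%:Z else - (2 * kk i)%:Z)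
  }.

(** What the order of the inner vertices has to satisfy.  All but [1 + frk i] of
    the vertices in a chain are on cycles, whose edges have to be odd. *)
Record layout (t N : nat) (lft frk : 'I_N -> bool) (kk : 'I_N -> nat) (s : nat -> int)
    (lab : 'I_t -> 'I_N) (att : 'I_N -> 'I_t) : Prop := Layout {
  att_lab : forall i, lab (att i) = i;
  att_last : forall i, is_attach lft lab (att i);
  chain_parity : forall i, odd (size (chain lft lab i)) = ~~ frk i;
  chain_cycles : forall i, (1 + frk i < size (chain lft lab i))%N -> odd (kk i);
  string_order : forall i j : 'I_N, j = i.+1 :> nat ->
    if 0 < s j then (att i < att j)%N else (att j < att i)%N
}.

(** * The cover determines the order of its vertices *)

Section Injectivity.
Variables (R : realType) (t N : nat).
Variables (lft frk : 'I_N -> bool) (kk : 'I_N -> nat) (s : nat -> int).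
Variable height : 'I_t -> R.
Hypothesis Hy : forall q q' : 'I_t, (q < q')%N -> height q < height q'.
Hypothesis Hs : string_data lft kk s.

(** Heights separate the inner vertices, so an isomorphism fixes each of them. *)
Lemma cover_iso_inner lab att lab' att' (q q' : 'I_t) :
  let c := zcover (R := R) lft frk kk s height lab att in
  let d := zcover (R := R) lft frk kk s height lab' att' in
  cover_iso c d -> forall e : edge c, joins e (inl q) (inl q') ->
  exists2 e' : edge d, joins e' (inl q) (inl q') & wt d e' = wt c e.
Proof.
move=> c d [fV [fE [[_ _ hj _] hp hw]]] e he.
have hV z : fV (inl z) = inl z.
  have := hp (inl z); case: (fV (inl z)) => [z'|w] /=.
    move=> [h]; congr inl; apply: val_inj => /=.
    by case: (ltngtP z z') => // /Hy; rewrite h ltxx.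
  by have [] := zphi_inr s height w => /= ->.
exists (fE e) => //; have := hj e; move: he; rewrite {1}/joins.
case/orP => /andP[/eqP -> /eqP ->]; rewrite !hV // joinsC //.
Qed.

Variables (lab lab' : 'I_t -> 'I_N) (att att' : 'I_N -> 'I_t).
Hypothesis Hl : layout lft frk kk s lab att.
Hypothesis Hl' : layout lft frk kk s lab' att'.
Hypothesis Hiso : cover_iso (zcover lft frk kk s height lab att)
    (zcover lft frk kk s height lab' att').
Hypothesis H0 : forall i : 'I_N, (i : nat) = 0%N -> att i = att' i.

Local Notation is_attach1 := (is_attach lft lab).
Local Notation is_attach2 := (is_attach lft lab').
Local Notation inward1 := (inward lft lab).
Local Notation inward2 := (inward lft lab').

(** Following the edges of odd weight from one attachment to the next, never
    going back, traces the string in both covers. *)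
Lemma iso_att i : att i = att' i.
Proof.
have [HN _ Hs0 Hst] := Hs; have [La Ia Pa _ _] := Hl; have [La' Ia' Pa' _ _] := Hl'.
case: i => n; elim/ltn_ind: n => n IH hn.
case: n IH hn => [|n] IH hn; first exact: H0.
have hn' := ltnW hn; have en := IH n (ltnSn n) hn'.
set i := Ordinal hn'; set j := Ordinal hn.
have hji : j = i.+1 :> nat by [].
have [e he hw] := edge_str frk height lab att Hs0 Hst hji.
have [e' he' hw'] := cover_iso_inner Hiso he.
have {}hw' : odd (zwt kk s e') by move: hw'; rewrite /= => ->.
have ei : att i = att' i by [].
have [[h _ _]|[_ h hq]|[_ hj' _ hlab]] := joins_inl La' Ia' Hs0 Hst HN he'.
- by move: h; rewrite ei Ia'.
- by move: hw'; rewrite hq ei (outer_wt_attach kk Pa') // Ia'.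
have hj2 : att' (lab' (att j)) = att j by apply/eqP; rewrite -(is_attachE La' Ia').
case: hlab; rewrite ei La' => hlab.
  by rewrite -hj2; congr att'; apply: val_inj; rewrite /= hlab.
have hk : (lab' (att j) : nat) = n.-1 by rewrite -[n]/(nat_of_ord i) hlab.
have hn2 : (n.-1 < N)%N by apply: leq_ltn_trans (leq_pred _) hn'.
have := IH n.-1 (leq_ltn_trans (leq_pred _) (ltnSn n)) hn2.
have -> : Ordinal hn2 = lab' (att j) by apply: val_inj; rewrite /= hk.
rewrite hj2 => /(can_inj La) /(congr1 val) /=; rewrite hk; lia.
Qed.

(** Induction on the distance [n] from the string, walking outwards: the edge
    that joins a vertex to its inward neighbour has to be an edge of the same
    kind in the other cover. *)
Lemma iso_chain n q : (size (chain lft lab (lab q)) - chain_index lft lab q = n.+1)%N ->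
  [/\ lab' q = lab q, is_attach2 q = is_attach1 q & ~~ is_attach1 q ->
      inward2 q = inward1 q].
Proof.
have [HN _ Hs0 Hst] := Hs; have [La Ia Pa _ _] := Hl; have [La' Ia' Pa' _ _] := Hl'.
elim: n q => [|n IH] q hn.
  have hq : is_attach1 q by rewrite /is_attach; apply/eqP; have :=
      chain_index_lt lft lab q; lia.
  have e : att' (lab q) = q by apply/eqP; rewrite -iso_att -(is_attachE La Ia).
  have e1 : lab' q = lab q by rewrite -{1}e La'.
  by split; rewrite ?hq // -e Ia'.
have hq : ~~ is_attach1 q by rewrite /is_attach; apply/eqP; lia.
have [e he hw] := edge_inward frk kk s height att hq.
have [e' he' hw'] := cover_iso_inner Hiso he.
have {}hw' : zwt kk s e' = outer_wt lft frk kk lab (inward1 q) by move: hw';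
    rewrite /= => ->.
have [hl2 ha2 hn2] : [/\ lab' (inward1 q) = lab (inward1 q),
    is_attach2 (inward1 q) = is_attach1 (inward1 q) &
    ~~ is_attach1 (inward1 q) -> inward2 (inward1 q) = inward1 (inward1 q)].
  by apply: IH; rewrite lab_inward // chain_index_inward //; lia.
have [[h1 h2 _]|[h1 h2 _]|[_ h1 h2 _]] := joins_inl La' Ia' Hs0 Hst HN he'.
- split; last by [].
    by rewrite -(lab_inward h1) -h2 hl2 lab_inward.
  by rewrite (negbTE h1) (negbTE hq).
- rewrite ha2 in h1; have := congr1 (chain_index lft lab) h2.
  by rewrite hn2 // !chain_index_inward //; lia.
- by move: h2; rewrite hw' (outer_wt_attach kk Pa) // -ha2.
Qed.

Lemma iso_lab q : lab' q = lab q.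
Proof.
have h := chain_index_lt lft lab q.
have [] // := @iso_chain (size (chain lft lab (lab q)) - chain_index lft lab q).-1 q.
by rewrite prednK // subn_gt0.
Qed.

End Injectivity.

(** * Layouts coded by words *)

Section WordLayout.
Variables (t N : nat) (i0 : 'I_N) (q0 : 'I_t) (lft : 'I_N -> bool) (w : seq nat).
Hypothesis Hsize : size w = t.
Hypothesis Hletters : all (fun x => x < N)%N w.

(** A word names, for each inner vertex in order of height, its tail. *)
Definition word_lab (q : 'I_t) : 'I_N := insubd i0 (nth 0%N w q).
Definition word_att (i : 'I_N) : 'I_t := last q0 (chain lft word_lab i).

Lemma val_word_lab q : word_lab q = nth 0%N w q :> nat.
Proof.
rewrite val_insubd (all_nthP _ Hletters) //.
by rewrite Hsize.
Qed.

Lemma size_word_chain (i : 'I_N) : size (chain lft word_lab i) = count_mem (i : nat) w.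
Proof.
have -> : size (chain lft word_lab i) = count (fun q => word_lab q == i) (enum 'I_t).
  by rewrite /chain; case: ifP => _; rewrite ?size_rev size_filter.
rewrite -[X in _ = count _ X](mkseq_nth 0%N w) Hsize /mkseq -val_enum_ord -map_comp
    [RHS]count_map.
by apply: eq_count => q /=; rewrite -val_word_lab.
Qed.

Lemma word_chain_gt0 (i : 'I_N) : (i : nat) \in w ->
    (0 < size (chain lft word_lab i))%N.
Proof. by rewrite size_word_chain -has_count has_pred1. Qed.

Lemma word_att_nth (i : 'I_N) : (i : nat) \in w ->
  word_att i = nth q0 (chain lft word_lab i) (size (chain lft word_lab i)).-1.
Proof. by rewrite /word_att (last_nth q0) => /word_chain_gt0; case: (chain _ _ _). Qed.

Lemma word_lab_att (i : 'I_N) : (i : nat) \in w -> word_lab (word_att i) = i.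
Proof.
by move=> h; rewrite word_att_nth // lab_nth_chain // prednK // word_chain_gt0.
Qed.

Lemma is_attach_word_att (i : 'I_N) : (i : nat) \in w ->
    is_attach lft word_lab (word_att i).
Proof.
move=> h; have h0 := word_chain_gt0 h.
by rewrite /is_attach word_lab_att // word_att_nth // chain_index_nth ?prednK.
Qed.

(** Chains are sorted by height and end with the attachment. *)
Lemma word_att_extremal (i : 'I_N) q : word_lab q = i ->
  if lft i then (q <= word_att i)%N else (word_att i <= q)%N.
Proof.
move=> hq; have hi : (i : nat) \in w.
  by rewrite -hq val_word_lab mem_nth // Hsize.
have hs := chain_sorted lft word_lab i.
have h0 := word_chain_gt0 hi; have := chain_index_lt lft word_lab q; rewrite hq => hr.
have [e|ne] := eqVneq (chain_index lft word_lab q) (size (chain lft word_lab i)).-1.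
  have -> : q = word_att i by rewrite word_att_nth // -e -hq nth_chain_index.
  by case: ifP.
have hlt : (chain_index lft word_lab q < (size (chain lft word_lab i)).-1)%N by lia.
have h1 : ((size (chain lft word_lab i)).-1 < size (chain lft word_lab i))%N by lia.
have := nth_chain_index lft word_lab q0 q; rewrite hq => <-; rewrite (word_att_nth hi).
case: ifP hs => hl hs; apply: ltnW.
  by have := sorted_ltn_nth (fun a b c : 'I_t => @ltn_trans a b c) q0 hs _ _ hr h1 hlt.
have tr : transitive (fun a b : 'I_t => (b < a)%N).
  by move=> a b c h2 h3; apply: ltn_trans h3 h2.
by have := sorted_ltn_nth tr q0 hs _ _ hr h1 hlt.
Qed.

(** Position of an attachment relative to a cut of the word, the form in which
    heights of attachments are compared. *)
Lemma word_att_cut w1 w2 (i : 'I_N) : w = w1 ++ w2 -> (i : nat) \in w ->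
  (word_att i < size w1)%N = if lft i then (i : nat) \notin w2 else (i : nat) \in w1.
Proof.
move=> hw hi.
have hpos : (i : nat) = nth 0%N w (word_att i) by rewrite -val_word_lab word_lab_att.
have in1 : (word_att i < size w1)%N -> (i : nat) \in w1.
  by move=> h; rewrite hpos hw nth_cat h mem_nth.
have in2 : (size w1 <= word_att i)%N -> (i : nat) \in w2.
  move=> h; rewrite hpos hw nth_cat ltnNge h /= mem_nth //.
  by rewrite ltn_subLR // -size_cat -hw Hsize.
case hl: (lft i); apply/idP/idP.
- move=> h; apply/negP => /(nthP 0%N)[r hr er].
  have hrt : (size w1 + r < t)%N by rewrite -Hsize hw size_cat ltn_add2l.
  have /word_att_extremal : word_lab (Ordinal hrt) = i.
    by apply: val_inj; rewrite /= val_word_lab /= hw nth_cat ltnNge leq_addr /= addKn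
        er.
  by rewrite hl /=; lia.
- by move=> h; rewrite ltnNge; apply: contra h => /in2.
- exact: in1.
- move=> /(nthP 0%N)[r hr er].
  have hrt : (r < t)%N by rewrite -Hsize hw size_cat ltn_addr.
  have /word_att_extremal : word_lab (Ordinal hrt) = i.
    by apply: val_inj; rewrite /= val_word_lab /= hw nth_cat hr er.
  by rewrite hl /= => h; apply: leq_ltn_trans hr.
Qed.

End WordLayout.

(** * Words with an alternating part *)

Section UpDown.
Variable up : nat -> bool.

(** A permutation of the numbers below [m] in which [j + 1] comes after [j] iff
    [up (j + 1)]: each new number is put at one of the two extremes, so that it
    is on the required side of all earlier ones. *)
Fixpoint updown (m : nat) : seq nat :=
  if m is m'.+1 then
    if up m' then rcons (updown m') m' else m' :: updown m'
  else [::].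

Lemma updown_perm m : perm_eq (updown m) (iota 0 m).
Proof.
elim: m => // m IH; rewrite -[in iota 0 _]addn1 iotaD add0n /=.
by case: ifP => _; rewrite -?cats1;
    [rewrite perm_cat2r | rewrite -cat1s perm_catC perm_cat2r].
Qed.

Lemma updown_split m j : (j.+1 < m)%N -> exists m1 m2, updown m = m1 ++ m2 /\
  if up j.+1 then (j \in m1) /\ (j.+1 \in m2) else (j.+1 \in m1) /\ (j \in m2).
Proof.
elim: m => // m IH; rewrite ltnS leq_eqVlt => /orP[/eqP hj|/IH].
  have hin : j \in updown m by rewrite (perm_mem (updown_perm m)) mem_iota -hj /=.
  rewrite /= -hj in hin *; case: ifP => h.
    by exists (updown j.+1), [:: j.+1]; rewrite cats1 !inE eqxx.
  by exists [:: j.+1], (updown j.+1); rewrite /= !inE eqxx.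
move=> [m1 [m2 [e h]]] /=; rewrite e; case: ifP => _.
  exists m1, (rcons m2 m); rewrite rcons_cat; split=> //.
  by case: ifP h => _ [h1 h2]; rewrite !mem_rcons !inE h1 h2 !orbT.
exists (m :: m1), m2; split=> //.
by case: ifP h => _ [h1 h2]; rewrite !inE h1 h2 !orbT.
Qed.

End UpDown.

Section Word.
Variables (N f n : nat) (lft frk : nat -> bool) (kk : nat -> nat) (s : nat -> int).

Definition alternating x := (f <= x < f + 2 * n)%N.

Hypothesis HfN : (f + 2 * n <= N)%N.
Hypothesis alt_lft : forall x, alternating x -> lft x = ~~ odd (x - f).
Hypothesis alt_frk : forall x, alternating x -> frk x.
Hypothesis alt_kk : forall x, alternating x -> kk x = 1%N.
Hypothesis alt_s : forall x, (f <= x <= f + 2 * n)%N -> (0 < s x) = odd (x - f).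

(** Tails outside the alternating part have no cycles.  Their forks are put
    below everything else on the left and above everything else on the right;
    what remains of them is the attachment. *)
Definition fixed_forks (b : bool) : seq nat :=
  [seq i <- iota 0 N | [&& ~~ alternating i, lft i == b & frk i]].
Definition fixed_attachments : seq nat :=
    [seq i <- updown (fun j => 0 < s j) N | ~~ alternating i].
(** The blocks [A] and [B] contain the alternating tails on the left and on the
    right.  The fixed attachments lie between them, since the string enters the
    alternating part downwards, to a tail on the left, and also leaves it
    downwards, from a tail on the right. *)
Definition word (A B : seq nat) : seq nat :=
  fixed_forks true ++ A ++ fixed_attachments ++ B ++ fixed_forks false.

(** Alternating tails are forked, so an even number of occurrences is what their
    chains need. *)
Definition good_block (b : bool) (A : seq nat) : Prop :=
  (forall x, x \in A -> alternating x /\ lft x = b) /\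
  (forall x, alternating x -> lft x = b -> x \in A /\ ~~ odd (count_mem x A)).

Lemma mem_fixed_forks b x : x \in fixed_forks b
    = [&& ~~ alternating x, lft x == b, frk x & (x < N)%N].
Proof. by rewrite mem_filter mem_iota /= add0n -!andbA. Qed.

Lemma mem_fixed_attachments x : x \in fixed_attachments = ~~ alternating x && (x < N)%N.
Proof. by rewrite mem_filter (perm_mem (updown_perm _ _)) mem_iota. Qed.

Lemma count_fixed_forks b x : (x < N)%N ->
    count_mem x (fixed_forks b) = [&& ~~ alternating x, lft x == b & frk x].
Proof.
move=> hx; rewrite count_uniq_mem ?filter_uniq ?iota_uniq // mem_fixed_forks hx.
by rewrite andbT.
Qed.

Lemma count_fixed_attachments x : (x < N)%N ->
    count_mem x fixed_attachments = ~~ alternating x.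
Proof.
move=> hx; rewrite count_uniq_mem ?mem_fixed_attachments ?hx ?andbT // filter_uniq //.
by rewrite (perm_uniq (updown_perm _ _)) iota_uniq.
Qed.

Lemma alt_lt x : alternating x -> (x < N)%N.
Proof. by rewrite /alternating => /andP[_ h]; apply: leq_trans h HfN. Qed.

Section Blocks.
Variables (A B : seq nat).
Hypothesis HA : good_block true A.
Hypothesis HB : good_block false B.

Lemma block_notin b C x : good_block b C -> ~~ (alternating x && (lft x == b)) ->
    x \notin C.
Proof.
by move=> [h _]; apply: contra => /h[-> ->]; rewrite eqxx.
Qed.

Lemma word_letters : all (fun x => x < N)%N (word A B).
Proof.
rewrite !all_cat; apply/and5P; split; apply/allP => x.
- by rewrite mem_fixed_forks => /and4P[].
- by case: HA => h _ /h[/alt_lt].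
- by rewrite mem_fixed_attachments => /andP[].
- by case: HB => h _ /h[/alt_lt].
- by rewrite mem_fixed_forks => /and4P[].
Qed.

Lemma count_fixed x : (x < N)%N -> ~~ alternating x ->
    count_mem x (word A B) = (1 + frk x)%N.
Proof.
move=> hx ha; rewrite !count_cat !count_fixed_forks // count_fixed_attachments // ha.
rewrite (count_memPn (block_notin HA _)) ?(negbTE ha) //.
rewrite (count_memPn (block_notin HB _)) ?(negbTE ha) //.
by case: (lft x); case: (frk x).
Qed.

Lemma count_alt x : alternating x -> (0 < count_mem x (word A B))%N &&
    ~~ odd (count_mem x (word A B)).
Proof.
move=> ha; have hx := alt_lt ha.
rewrite !count_cat !count_fixed_forks // count_fixed_attachments // ha /= add0n add0n
    addn0.
case hl: (lft x).
  have [h1 h2] := HA.2 x ha hl.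
  rewrite (count_memPn (block_notin HB _)) ?hl ?andbF // addn0 h2 andbT.
  by rewrite -has_count has_pred1.
have [h1 h2] := HB.2 x ha hl.
rewrite (count_memPn (block_notin HA _)) ?hl ?andbF // add0n h2 andbT.
by rewrite -has_count has_pred1.
Qed.

Lemma mem_word x : (x < N)%N -> x \in word A B.
Proof.
move=> hx; rewrite -has_pred1 has_count; case: (boolP (alternating x)) => ha.
  by case/andP: (count_alt ha).
by rewrite count_fixed.
Qed.

Variables (t : nat) (i0 : 'I_N) (q0 : 'I_t).
Hypothesis Ht : size (word A B) = t.
Local Notation lf := (fun i : 'I_N => lft i).
Local Notation lab := (word_lab i0 (word A B)).
Local Notation att := (word_att i0 q0 lf (word A B)).

Definition before i j := exists w1 w2, [/\ word A B = w1 ++ w2,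
  if lft i then i \notin w2 else i \in w1 & if lft j then j \in w2 else j \notin w1].

Lemma before_att (i j : 'I_N) : before i j -> (att i < att j)%N.
Proof.
move=> [w1 [w2 [e hi hj]]].
have ci := word_att_cut i0 q0 lf Ht word_letters e (mem_word (ltn_ord i)).
have cj := word_att_cut i0 q0 lf Ht word_letters e (mem_word (ltn_ord j)).
rewrite -ci in hi; apply: leq_trans hi _; rewrite leqNgt cj.
by case: ifP hj => _ // ->.
Qed.

(** If one of the two tails is alternating, a cut next to one of the blocks
    separates the attachments; otherwise both are among the fixed ones, whose
    order was chosen for this purpose. *)
Lemma word_order (j : nat) : (j.+1 < N)%N ->
  if 0 < s j.+1 then before j j.+1 else before j.+1 j.
Proof.
move=> hj; have hj' := ltnW hj.
have nA x : ~~ (alternating x && lft x) -> x \notin A.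
  by move=> h; apply: (block_notin HA); rewrite eqb_id.
have nB x : ~~ (alternating x && ~~ lft x) -> x \notin B.
  by move=> h; apply: (block_notin HB); rewrite eqbF_neg.
have iA x : alternating x -> lft x -> x \in A by move=> h1 h2; case: (HA.2 x h1 h2).
have iB x : alternating x -> ~~ lft x -> x \in B.
  by move=> h1 /negbTE h2; case: (HB.2 x h1 h2).
have cutA a b : alternating a -> lft a -> ~~ (alternating b && lft b) -> (b < N)%N ->
    before a b.
  move=> aa la hb bN; exists (fixed_forks true ++ A),
      (fixed_attachments ++ B ++ fixed_forks false).
  rewrite -catA la; split=> //.
    by rewrite !mem_cat mem_fixed_attachments mem_fixed_forks aa /= orbF nB // la andbF.
  case: ifP hb => lb hb; first by rewrite mem_cat mem_fixed_attachments
      -[alternating b]andbT hb bN.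
  by rewrite mem_cat mem_fixed_forks lb andbF /= nA // lb andbF.
have cutB a b : alternating b -> ~~ lft b -> ~~ (alternating a && ~~ lft a) ->
    (a < N)%N -> before a b.
  move=> ab lb ha aN; exists (fixed_forks true ++ A ++ fixed_attachments),
      (B ++ fixed_forks false).
  rewrite -!catA (negbTE lb); split=> //.
    case: ifP ha => la ha; first by rewrite mem_cat mem_fixed_forks la andbF /= orbF
        nB // la andbF.
    by rewrite !mem_cat mem_fixed_attachments -[alternating a]andbT ha aN !orbT.
  by rewrite !mem_cat mem_fixed_attachments mem_fixed_forks ab /= orbF nA //
      (negbTE lb) andbF.
have cutM a b m1 m2 : updown (fun j => 0 < s j) N = m1 ++ m2 -> a \in m1 -> b \in m2 ->
    ~~ alternating a -> ~~ alternating b -> before a b.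
  move=> e ha hb na nb.
  have um : uniq (m1 ++ m2) by rewrite -e (perm_uniq (updown_perm _ _)) iota_uniq.
  move: um; rewrite cat_uniq => /and3P[_ /hasPn um _].
  have am2 : a \notin m2 by apply/negP => h; case/negP: (um _ h).
  have bm1 : b \notin m1 by exact: um.
  have em : fixed_attachments = [seq i <- m1 | ~~ alternating i]
      ++ [seq i <- m2 | ~~ alternating i].
    by rewrite /fixed_attachments e filter_cat.
  exists (fixed_forks true ++ A ++ [seq i <- m1 | ~~ alternating i]),
      ([seq i <- m2 | ~~ alternating i] ++ B ++ fixed_forks false).
  split; first by rewrite /word em -!catA.
    case: ifP => la; last by rewrite !mem_cat mem_fixed_forks mem_filter na ha !orbT.
    by rewrite !mem_cat mem_fixed_forks mem_filter la (negbTE am2) !andbF orbF /= nB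
        // (negbTE na).
  case: ifP => lb; first by rewrite !mem_cat mem_fixed_forks mem_filter nb hb.
  by rewrite !mem_cat mem_fixed_forks mem_filter lb (negbTE bm1) !andbF orbF /= nA //
      (negbTE nb).
case: (boolP (alternating j)) => aj; case: (boolP (alternating j.+1)) => aj1.
- have := alt_lft aj; have := alt_lft aj1.
  rewrite alt_s; last by move: aj1; rewrite /alternating; lia.
  have -> : (j.+1 - f)%N = (j - f).+1 by move: aj; rewrite /alternating; lia.
  rewrite /= negbK; case: (odd _) => l1 l2.
    by apply: cutB => //; rewrite ?l1 ?l2 ?andbF.
  by apply: cutA => //; rewrite ?l1 ?l2 ?andbF.
- have e : j.+1 = (f + 2 * n)%N by move: aj aj1; rewrite /alternating; lia.
  rewrite alt_s; last by rewrite e; lia.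
  have -> : odd (j.+1 - f) = false by rewrite e addKn oddM.
  apply: cutB => //; last by rewrite negb_and aj1.
  rewrite alt_lft // negbK.
  have : odd (j - f).+1 = false; last by move=> /= /negbFE.
  have -> : (j - f).+1 = (2 * n)%N by move: aj; rewrite /alternating; lia.
  by rewrite oddM.
- have e : j.+1 = f by move: aj aj1; rewrite /alternating; lia.
  rewrite alt_s; last by rewrite e; lia.
  rewrite e subnn /=; apply: cutA => //; rewrite ?e.
  + by move: aj1; rewrite e.
  + by rewrite alt_lft ?subnn //; move: aj1; rewrite e.
  + by rewrite negb_and aj.
- have [m1 [m2 [e]]] := updown_split (fun j => 0 < s j) hj.
  by case: ifP => _ [h1 h2]; apply: cutM e _ _ _ _.
Qed.

Lemma word_layout :
  layout lf (fun i : 'I_N => frk i) (fun i : 'I_N => kk i) s lab att.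
Proof.
have Hm (i : 'I_N) := mem_word (ltn_ord i).
split.
- by move=> i; apply: word_lab_att (word_letters) _ (Hm i).
- by move=> i; apply: is_attach_word_att (word_letters) _ (Hm i).
- move=> i; rewrite size_word_chain ?word_letters //; case: (boolP (alternating i)) =>
    ha.
    by case/andP: (count_alt ha) => _ /negbTE ->; rewrite alt_frk.
  by rewrite count_fixed //; case: (frk i).
- move=> i; rewrite size_word_chain ?word_letters //; case: (boolP (alternating i)) =>
    ha.
    by rewrite alt_kk.
  by rewrite count_fixed // ltnn.
- move=> i j hij; have hj : (i.+1 < N)%N by rewrite -hij.
  have := word_order hj; rewrite hij.
  by case: ifP => _ h; apply: before_att; rewrite ?hij.
Qed.

(** The height of a fixed attachment depends on the sizes of the blocks only:
    this supplies a common starting point for reading off the words of two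
    isomorphic covers. *)
Lemma word_att_fixed (i : 'I_N) : ~~ alternating i ->
  att i = (size (fixed_forks true) + size A + index (i : nat) fixed_attachments)%N :>
      nat.
Proof.
move=> hi; have him : (i : nat) \in fixed_attachments by rewrite mem_fixed_attachments
    hi ltn_ord.
have mw : uniq fixed_attachments by rewrite filter_uniq //
    (perm_uniq (updown_perm _ _)) iota_uniq.
set r := index _ _; have hr : (r < size fixed_attachments)%N by rewrite index_mem.
have nA : (i : nat) \notin A by apply: (block_notin HA); rewrite (negbTE hi).
have nB : (i : nat) \notin B by apply: (block_notin HB); rewrite (negbTE hi).
have cut r' : (r' <= size fixed_attachments)%N ->
    (att i < size (fixed_forks true) + size A + r')%N = (r < r')%N.
  move=> hr'.
  have e : word A B = (fixed_forks true ++ A ++ take r' fixed_attachments)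
      ++ (drop r' fixed_attachments ++ B ++ fixed_forks false).
    by rewrite /word -!catA (catA (take _ _)) cat_take_drop.
  have := word_att_cut i0 q0 lf Ht word_letters e (mem_word (ltn_ord i)).
  rewrite !size_cat size_takel // addnA => ->.
  have ht : ((i : nat) \in take r' fixed_attachments) = (r < r')%N by rewrite
      in_take_leq.
  have hd : ((i : nat) \in drop r' fixed_attachments) = ~~ (r < r')%N.
    rewrite -ht; move: mw him; rewrite -{1 2}(cat_take_drop r' fixed_attachments)
        cat_uniq mem_cat.
    move=> /and3P[_ /hasPn h _]; case: (boolP (_ \in drop _ _)) => h1.
      by have /= := h _ h1 => /negbTE ->.
    by rewrite orbF => ->.
  case: ifP => hl.
    by rewrite !mem_cat hd (negbTE nB) mem_fixed_forks hl andbF /= orbF negbK.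
  by rewrite !mem_cat ht (negbTE nA) mem_fixed_forks hl andbF.
have := cut r (ltnW hr); have := cut r.+1 hr; lia.
Qed.

End Blocks.
End Word.

(** * A large family of blocks *)

Section EvenWords.
Local Open Scope nat_scope.
Variables (k : nat).

Definition odd_letters (x : seq nat) := [seq r <- iota 0 k | odd (count_mem r x)].

Lemma size_odd_letters_le x : size (odd_letters x) <= k.
Proof. by rewrite size_filter (leq_trans (count_size _ _)) // size_iota. Qed.

Lemma count_letters x : all (fun r => r < k) x ->
    size x = \sum_(r < k) count_mem (r : nat) x.
Proof.
elim: x => [|a x IH] /=; first by rewrite big1.
case/andP => ha hx; rewrite big_split /= -(IH hx) (bigD1 (Ordinal ha)) //= eqxx.
by rewrite big1 ?addn0 // => r; rewrite -val_eqE /= eq_sym => /negbTE ->.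
Qed.

(** The length is the sum of the multiplicities, taken modulo 2 here. *)
Lemma odd_size_odd_letters x : all (fun r => r < k) x ->
  odd (size (odd_letters x)) = odd (size x).
Proof.
move=> hx; rewrite (count_letters hx) size_filter -sum1_count.
rewrite -[X in iota 0 X](subn0 k) big_mkord big_mkcond /=.
apply: (big_ind2 (fun a b => odd a = odd b)) => // [a b c d h1 h2|r _].
  by rewrite !oddD h1 h2.
by case: ifP.
Qed.

(** Repeating the letters of odd multiplicity makes all multiplicities even; the
    number of letters 0 that fill the rest is even if [l] is even. *)
Definition even_completion (l : nat) (x : seq nat) :=
  x ++ odd_letters x ++ nseq (l - size x - size (odd_letters x)) 0.

(** If [l < k] the truncated subtraction makes [x] empty, and nothing has to be
    repeated. *)
Lemma size_odd_letters x l : size x = l - k -> size x + size (odd_letters x) <= l.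
Proof.
move=> hx; have := size_odd_letters_le x; case: (leqP k l) => h; first lia.
have x0 : x = [::] by apply: size0nil; lia.
by rewrite x0 /odd_letters /=; have ->
    : [seq r <- iota 0 k | false] = [::] by elim: (iota 0 k).
Qed.

Lemma size_even_completion l x : size x = l - k -> size (even_completion l x) = l.
Proof.
by move=> hx; rewrite !size_cat size_nseq addnA -subnDA subnKC // size_odd_letters.
Qed.

Lemma even_completion_even l x r : size x = l - k -> all (fun r => r < k) x ->
    ~~ odd l ->
  ~~ odd (count_mem r (even_completion l x)).
Proof.
move=> hx hk hl; rewrite !count_cat count_nseq.
have ho := size_odd_letters hx; have hp := odd_size_odd_letters hk.
have he : ~~ odd (l - size x - size (odd_letters x)).
  by rewrite -subnDA oddB // oddD hp addbb addbF.
rewrite addnA oddD oddM (negbTE he) andbF addbF.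
have -> : count_mem r (odd_letters x) = odd (count_mem r x).
  rewrite count_uniq_mem ?filter_uniq ?iota_uniq // mem_filter mem_iota /= add0n.
  case: (ltnP r k) => hr; rewrite ?andbT // andbF (count_memPn _) //.
  by apply/negP => /(allP hk); rewrite ltnNge hr.
by rewrite oddD oddb addbb.
Qed.

Lemma even_completion_mem l x r : all (fun r => r < k) x ->
  r \in even_completion l x -> (r < k) || (r == 0).
Proof.
move=> hk; rewrite !mem_cat mem_filter mem_iota add0n mem_nseq.
by case/or3P => [/(allP hk) -> //|/and3P[_ _ ->] //|/andP[_ ->]]; rewrite orbT.
Qed.

Lemma even_completion_inj l x x' : size x = size x' ->
    even_completion l x = even_completion l x' ->
  x = x'.
Proof. by move=> hs /eqP; rewrite /even_completion eqseq_cat // => /andP[/eqP]. Qed.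

End EvenWords.

Section Blocks.
Local Open Scope nat_scope.
Variables (f n g k : nat) (lft : nat -> bool).
Hypothesis alt_lft : forall x, alternating f n x -> lft x = ~~ odd (x - f).

Definition perm_seq (p : 'S_n) : seq nat := [seq (p i : nat) | i <- enum 'I_n].

Lemma size_perm_seq p : size (perm_seq p) = n.
Proof. by rewrite size_map size_enum_ord. Qed.

Lemma perm_seq_inj : injective perm_seq.
Proof.
move=> p p' /eq_in_map h; apply/perm.permP => i; apply: val_inj.
by apply: h; rewrite mem_enum.
Qed.

Lemma count_perm_seq p r : count_mem r (perm_seq p) = (r < n) :> nat.
Proof.
have u : uniq (perm_seq p).
  by rewrite map_inj_uniq ?enum_uniq // => i j /val_inj /perm_inj.
rewrite count_uniq_mem //; congr nat_of_bool; apply/mapP/idP => [[i _ ->] //|h].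
by exists ((p^-1)%g (Ordinal h)); rewrite ?mem_enum // permKV.
Qed.

Definition letter (b : bool) (r : nat) : nat := f + 2 * r + ~~ b.

Lemma letter_inj b : injective (letter b).
Proof. by move=> x y; rewrite /letter; lia. Qed.

Lemma good_block_map (b : bool) (v : seq nat) :
  (forall r, r \in v -> r < n) ->
  (forall r, r < n -> r \in v /\ ~~ odd (count_mem r v)) ->
  good_block f n lft b [seq letter b r | r <- v].
Proof.
move=> h1 h2; split=> [_ /mapP[r /h1 hr ->]|x hx hl].
  have ha : alternating f n (letter b r) by rewrite /alternating /letter; case: b; lia.
  by split=> //; rewrite alt_lft // /letter -addnA addKn oddD oddM /=; case: b {ha}.
have [r hr ->] : exists2 r, r < n & x = letter b r.
  move: (alt_lft hx); rewrite hl => hb; exists (x - f)./2.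
    by move: hx; rewrite /alternating; lia.
  by rewrite /letter; move: hx; rewrite /alternating; lia.
have [h3 h4] := h2 r hr; rewrite map_f //; split=> //.
rewrite count_map (eq_count (a2 := pred1 r)) // => z /=.
by rewrite (inj_eq (@letter_inj b)).
Qed.

(** First the forks, then the vertices of cycles, then the attachments. *)
Definition block_left (p p' : 'S_n) (x : (2 * g - k).-tuple 'I_k) : seq nat :=
  [seq letter true r | r <- perm_seq p ++ even_completion k (2 * g)
      [seq nat_of_ord i | i <- tval x] ++ perm_seq p'].
Definition block_right (p p' : 'S_n) : seq nat :=
  [seq letter false r | r <- perm_seq p ++ perm_seq p'].

Lemma mem_perm_seq p r : (r \in perm_seq p) = (r < n).
Proof. by rewrite -has_pred1 has_count count_perm_seq; case: (r < n). Qed.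

Lemma tuple_letters (x : (2 * g - k).-tuple 'I_k) :
  all (fun r => r < k) [seq nat_of_ord i | i <- tval x].
Proof. by apply/allP => _ /mapP[i _ ->]. Qed.

Lemma tuple_size (x : (2 * g - k).-tuple 'I_k) :
  size [seq nat_of_ord i | i <- tval x] = 2 * g - k.
Proof. by rewrite size_map size_tuple. Qed.

Hypotheses (Hn : 0 < n) (Hkn : k <= n).

Lemma good_block_left p p' x : good_block f n lft true (block_left p p' x).
Proof.
apply: good_block_map => [r|r hr].
  rewrite mem_cat mem_perm_seq => /orP[//|].
  rewrite mem_cat mem_perm_seq => /orP[|//].
  move=> /(even_completion_mem (tuple_letters x)) /orP[h|/eqP -> //].
  exact: leq_trans h Hkn.
rewrite mem_cat mem_perm_seq hr; split=> //.
rewrite count_cat [X in _ + X]count_cat !count_perm_seq hr !oddD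
    (negbTE (even_completion_even _ _ _ _)) ?oddM //.
- exact: tuple_size.
- exact: tuple_letters.
Qed.

Lemma good_block_right p p' : good_block f n lft false (block_right p p').
Proof.
apply: good_block_map => [r|r hr]; rewrite mem_cat !mem_perm_seq ?orbb //.
by rewrite hr !count_cat !count_perm_seq hr.
Qed.

Lemma size_block_left p p' x : size (block_left p p' x) = 2 * n + 2 * g.
Proof.
by rewrite size_map size_cat [X in _ + X]size_cat !size_perm_seq size_even_completion
    ?tuple_size //;
  clear; lia.
Qed.

Lemma size_block_right p p' : size (block_right p p') = 2 * n.
Proof. by rewrite size_map !size_cat !size_perm_seq; clear; lia. Qed.

Lemma block_left_inj p p' x q q' z : block_left p p' x = block_left q q' z ->
  [/\ p = q, p' = q' & x = z].
Proof.
move/(inj_map (@letter_inj true)) => /eqP.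
rewrite eqseq_cat ?size_perm_seq // => /andP[/eqP/perm_seq_inj -> ].
rewrite eqseq_cat ?size_even_completion ?tuple_size // =>
    /andP[/eqP h /eqP/perm_seq_inj ->].
split=> //; move/even_completion_inj: h; rewrite !tuple_size => /(_ erefl).
by move/(inj_map val_inj)/val_inj.
Qed.

Lemma block_right_inj p p' q q' : block_right p p' = block_right q q' ->
    p = q /\ p' = q'.
Proof.
move/(inj_map (@letter_inj false)) => /eqP.
by rewrite eqseq_cat ?size_perm_seq // =>
    /andP[/eqP/perm_seq_inj -> /eqP/perm_seq_inj ->].
Qed.

End Blocks.

(** * Splitting partitions into tails and string ends *)

(** A tail is given by its side (true for the left one), whether it starts with a
    fork, and the number [k] such that its attaching edge has weight [2k]. *)
Definition tail_type : Type := (bool * bool * nat)%type.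
Definition tail_left (d : tail_type) := d.1.1.
Definition tail_forked (d : tail_type) := d.1.2.
Definition tail_k (d : tail_type) := d.2.
Definition tail_flow (d : tail_type) : int :=
  if tail_left d then (2 * tail_k d)%:Z else - (2 * tail_k d)%:Z.
Definition ends_of_tail (d : tail_type) : seq nat :=
  nseq (1 + tail_forked d) (if tail_forked d then tail_k d else (2 * tail_k d)%N).
Arguments ends_of_tail : simpl never.
Definition ends_of_tails (b : bool) (T : seq tail_type) : seq nat :=
  flatten [seq ends_of_tail d | d <- T & tail_left d == b].
Definition total_flow (T : seq tail_type) : int := \sum_(d <- T) tail_flow d.
(** A string that starts with a positive signed weight starts on the left, one
    that stops with a positive signed weight stops on the right. *)
Definition string_ends (b : bool) (s0 sN : int) : seq nat :=
  (if (0 < s0) == b then [:: `|s0|%N] else [::]) ++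
  (if (0 < sN) == b then [::] else [:: `|sN|%N]).

Lemma ends_of_tails_cons b d T :
  ends_of_tails b (d :: T) = (if tail_left d == b then ends_of_tail d else [::])
      ++ ends_of_tails b T.
Proof. by rewrite /ends_of_tails; case: (eqVneq (tail_left d) b) =>
    /= [->|/negbTE ->]; rewrite ?eqxx. Qed.

Lemma ends_of_tails_cat b T T' : ends_of_tails b (T ++ T') = ends_of_tails b T
    ++ ends_of_tails b T'.
Proof. by rewrite /ends_of_tails filter_cat map_cat flatten_cat. Qed.

Lemma total_flow_cat T T' : total_flow (T ++ T') = total_flow T + total_flow T'.
Proof. by rewrite /total_flow big_cat. Qed.

Lemma sumn_ends_of_tail d : sumn (ends_of_tail d) = (2 * tail_k d)%N.
Proof. by rewrite /ends_of_tail sumn_nseq; case: (tail_forked d); lia. Qed.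

(** Balancing of a tail: its ends have total weight [2k], with or without fork. *)
Lemma total_flow_ends T : total_flow T = (sumn (ends_of_tails true T))%:Z -
    (sumn (ends_of_tails false T))%:Z.
Proof.
elim: T => [|d T IH]; first by rewrite /total_flow big_nil.
rewrite /total_flow big_cons -/(total_flow T) IH !ends_of_tails_cons !sumn_cat
    !(fun_if sumn) sumn_ends_of_tail /tail_flow.
by case: (tail_left d); rewrite /=; lia.
Qed.

Lemma odd_sumn_ends_of_tails b T : ~~ odd (sumn (ends_of_tails b T)).
Proof.
elim: T => [|d T IH] //; rewrite ends_of_tails_cons sumn_cat oddD (fun_if sumn)
    sumn_ends_of_tail.
by rewrite (negbTE IH) addbF; case: ifP; rewrite ?oddM.
Qed.

(** Its size is [odd_mult_odds la]. *)
Definition unpaired (la : seq nat) : seq nat :=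
  [seq v <- undup la | odd v && odd (count_mem v la)].

Definition value_tails (b : bool) (la : seq nat) (v : nat) : seq tail_type :=
  if odd v then nseq (count_mem v la)./2 (b, true, v) else nseq (count_mem v la)
      (b, false, v./2).

Lemma ends_of_tails_nseq b c d : ends_of_tails b (nseq c d) =
  if tail_left d == b then flatten (nseq c (ends_of_tail d)) else [::].
Proof.
elim: c => [|c IH]; first by case: ifP.
by rewrite /= ends_of_tails_cons IH; case: ifP.
Qed.

Lemma flatten_nseq2 c v : flatten (nseq c [:: v; v]) = nseq c.*2 v :> seq nat.
Proof. by elim: c => //= c ->. Qed.

Lemma flatten_nseq1 c v : flatten (nseq c [:: v]) = nseq c v :> seq nat.
Proof. by elim: c => //= c ->. Qed.

Lemma value_tails_ends b la v : perm_eq (nseq (count_mem v la) v)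
  (ends_of_tails b (value_tails b la v)
      ++ (if odd v && odd (count_mem v la) then [:: v] else [::])).
Proof.
rewrite /value_tails; case hv: (odd v);
    rewrite ends_of_tails_nseq /tail_left /= eqxx /ends_of_tail /=.
  rewrite flatten_nseq2 -{1}[count_mem v la]odd_double_half.
  by case: (odd _); rewrite ?cats0 // cats1 perm_sym perm_rcons.
rewrite cats0 flatten_nseq1 mul2n.
by have := odd_double_half v; rewrite hv add0n => ->.
Qed.

Lemma perm_flatten_cat (I : Type) (r : seq I) (F G : I -> seq nat) :
  perm_eq (flatten [seq F i ++ G i | i <- r])
      (flatten [seq F i | i <- r] ++ flatten [seq G i | i <- r]).
Proof.
elim: r => //= i r IH; rewrite -!catA perm_cat2l.
by rewrite (perm_trans (perm_cat (perm_refl _) IH)) // perm_catCA.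
Qed.

(** Value by value: an even value is the end of a tail without fork, two copies of
    an odd value form a fork. *)
Lemma decompose_side (b : bool) (la : seq nat) : is_partition la ->
  exists T : seq tail_type, [/\ all (fun d => tail_left d == b) T,
      all (fun d => 0 < tail_k d)%N T &
    perm_eq la (ends_of_tails b T ++ unpaired la)].
Proof.
move=> hla; exists (flatten [seq value_tails b la v | v <- undup la]).
have hin d : d \in flatten [seq value_tails b la v | v <- undup la] ->
    tail_left d == b /\ (0 < tail_k d)%N.
  case/flattenP => _ /mapP[v hv ->]; rewrite mem_undup in hv.
  have hv0 : (0 < v)%N := allP hla v hv.
  rewrite /value_tails; case ho: (odd v); rewrite mem_nseq => /andP[_ /eqP ->];
    rewrite /tail_left /tail_k /= eqxx; split=> //.
  by case: v ho hv0 {hv} => [|[|v]].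
split; [by apply/allP => d /hin[] | by apply/allP => d /hin[] |].
have := perm_count_undup la; rewrite perm_sym => /perm_trans; apply.
set r := undup la.
have -> : ends_of_tails b (flatten [seq value_tails b la v | v <- r]) =
    flatten [seq ends_of_tails b (value_tails b la v) | v <- r].
  by elim: r => //= v r IH; rewrite ends_of_tails_cat IH.
have -> : unpaired la = flatten
    [seq (if odd v && odd (count_mem v la) then [:: v] else [::]) | v <- r].
  by rewrite /unpaired -/r; elim: r => //= v r ->; case: ifP.
apply: perm_trans (perm_flatten_cat _ _ _).
elim: r => //= v r IH; apply: perm_cat => //; exact: value_tails_ends.
Qed.

Lemma odd_sumn (s : seq nat) : all odd s -> odd (sumn s) = odd (size s).
Proof. by elim: s => //= a s IH /andP[ha /IH h]; rewrite oddD ha h. Qed.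

(** The additional pair of ones serves as the pair of string ends on the left if
    there are no unpaired values, and as a fork otherwise; on the right it always
    is a fork, so the list of tails is not empty. *)
Lemma decompose (la mu : seq nat) : is_partition la -> is_partition mu ->
  sumn la = sumn mu -> (odd_mult_odds la + odd_mult_odds mu <= 2)%N ->
  exists (T : seq tail_type) (s0 : int),
      [/\ all (fun d => 0 < tail_k d)%N T, (0 < size T)%N, odd `|s0|,
    perm_eq (la ++ [:: 1; 1]%N) (ends_of_tails true T ++ string_ends true s0
        (s0 + total_flow T)) &
    perm_eq (mu ++ [:: 1; 1]%N) (ends_of_tails false T ++ string_ends false s0
        (s0 + total_flow T))].
Proof.
move=> hla hmu hs; rewrite /odd_mult_odds -!/(unpaired _) => ho.
have [TL [sL kL pL]] := decompose_side true hla.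
have [TR [sR kR pR]] := decompose_side false hmu.
have ou (l : seq nat) : all odd (unpaired l).
  by apply/allP => v; rewrite mem_filter => /andP[/andP[]].
have tL : ends_of_tails false TL = [::].
  rewrite /ends_of_tails; suff -> : [seq d <- TL | tail_left d == false] = [::] by [].
  by apply/eqP; rewrite -[_ == _]negbK -has_filter -all_predC; apply: sub_all sL =>
      d /= /eqP ->.
have tR : ends_of_tails true TR = [::].
  rewrite /ends_of_tails; suff -> : [seq d <- TR | tail_left d == true] = [::] by [].
  by apply/eqP; rewrite -[_ == _]negbK -has_filter -all_predC; apply: sub_all sR =>
      d /= /eqP ->.
have eL := perm_sumn pL; have eR := perm_sumn pR.
rewrite !sumn_cat in eL eR.
have par : odd (size (unpaired la)) = odd (size (unpaired mu)).
  rewrite -!odd_sumn //; have := odd_sumn_ends_of_tails true TL; have :=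
      odd_sumn_ends_of_tails false TR.
  by have := congr1 odd hs; rewrite eL eR !oddD;
      do 2 case: (odd (sumn (ends_of_tails _ _))).
have fin (T0 : seq tail_type) (s0 : int) (SL SR : seq nat) (T := TL ++ TR ++ T0) :
  all (fun d => 0 < tail_k d)%N T0 -> (0 < size T0)%N -> odd `|s0| ->
  perm_eq (unpaired la ++ [:: 1; 1]%N) (ends_of_tails true T0 ++ SL) ->
  perm_eq (unpaired mu ++ [:: 1; 1]%N) (ends_of_tails false T0 ++ SR) ->
  (forall sN, sN = s0 + (sumn SR)%:Z - (sumn SL)%:Z ->
      SL = string_ends true s0 sN /\ SR = string_ends false s0 sN) ->
  exists (T : seq tail_type) (s0 : int),
      [/\ all (fun d => 0 < tail_k d)%N T, (0 < size T)%N, odd `|s0|,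
    perm_eq (la ++ [:: 1; 1]%N) (ends_of_tails true T ++ string_ends true s0
        (s0 + total_flow T)) &
    perm_eq (mu ++ [:: 1; 1]%N) (ends_of_tails false T ++ string_ends false s0
        (s0 + total_flow T))].
  move=> k0 n0 os h1 h2 h3; exists T, s0.
  have g1 : perm_eq (la ++ [:: 1; 1]%N) (ends_of_tails true T ++ SL).
    rewrite !ends_of_tails_cat tR /= (perm_trans (perm_cat pL (perm_refl _))) //.
    by rewrite -!catA perm_cat2l.
  have g2 : perm_eq (mu ++ [:: 1; 1]%N) (ends_of_tails false T ++ SR).
    rewrite !ends_of_tails_cat tL /= (perm_trans (perm_cat pR (perm_refl _))) //.
    by rewrite -!catA perm_cat2l.
  have [|<- <-] := h3 (s0 + total_flow T).
    have := perm_sumn g1; have := perm_sumn g2; rewrite !sumn_cat total_flow_ends hs.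
    move: (sumn mu) (sumn SL) (sumn SR) (sumn (ends_of_tails _ T))
        (sumn (ends_of_tails _ T)).
    by clear=> /= a b c d e; lia.
  by split=> //; rewrite ?all_cat ?kL ?kR // !size_cat !addn_gt0 n0 !orbT.
have pos0 v : odd v -> (0 < v%:Z) by case: v.
have neg0 v : (0 < - v%:Z) = false by clear; lia.
(* two string ends on the left without unpaired values, both on the right, one on
   each side, both on the left; all other cases contradict [ho] or [par] *)
case uL: (unpaired la) (ou la) par ho fin => [|a [|a' [|? ?]]] oL;
  case uR: (unpaired mu) (ou mu) => [|b [|b' [|? ?]]] oR //= par ho fin.
- by apply: (fin [:: (false, true, 1%N)] 1 [:: 1; 1]%N [::]) => // sN ->.
- apply: (fin [:: (false, true, 1%N); (true, true, 1%N)] (- b%:Z) [::] [:: b; b']) =>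
    //.
  + by rewrite abszN; case/andP: oR.
  + by rewrite /ends_of_tails /= -[_ :: _]/([:: b; b'] ++ _) perm_catC.
  + move=> sN ->; have -> : - b%:Z + (sumn [:: b; b'])%:Z - (sumn [::])%:Z = b'%:Z
      by rewrite /=; clear; lia.
    by rewrite /string_ends !neg0 abszN !pos0 //; case/andP: oR => // _ /andP[].
- apply: (fin [:: (false, true, 1%N); (true, true, 1%N)] a%:Z [:: a] [:: b]) => //.
  + by case/andP: oL.
  + by rewrite /ends_of_tails /= -[_ :: _]/([:: a] ++ _) perm_catC.
  + by rewrite /ends_of_tails /= -[_ :: _]/([:: b] ++ _) perm_catC.
  + move=> sN ->; have -> : a%:Z + (sumn [:: b])%:Z - (sumn [:: a])%:Z = b%:Z
      by rewrite /=; clear; lia.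
    by rewrite /string_ends !pos0 //; [case/andP: oR | case/andP: oL].
- apply: (fin [:: (false, true, 1%N); (true, true, 1%N)] a%:Z [:: a; a'] [::]) => //.
  + by case/andP: oL.
  + by rewrite /ends_of_tails /= -[_ :: _]/([:: a; a'] ++ _) perm_catC.
  + move=> sN ->; have -> : a%:Z + (sumn [::])%:Z - (sumn [:: a; a'])%:Z = - a'%:Z
      by rewrite /=; clear; lia.
    by rewrite /string_ends neg0 abszN pos0 //; case/andP: oL.
Qed.

(** * The lower bound on zigzag numbers *)

Section TailList.
Variables (tail_list : seq tail_type) (s0 : int).
Definition default_tail : tail_type := (true, true, 1%N).
Definition left_at j := tail_left (nth default_tail tail_list j).
Definition forked_at j := tail_forked (nth default_tail tail_list j).
Definition k_at j := tail_k (nth default_tail tail_list j).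
Definition string_wt j := s0 + total_flow (take j tail_list).
Local Notation N := (size tail_list).

Lemma string_wt0 : string_wt 0 = s0.
Proof. by rewrite /string_wt take0 /total_flow big_nil addr0. Qed.

Lemma string_wtN : string_wt N = s0 + total_flow tail_list.
Proof. by rewrite /string_wt take_size. Qed.

Lemma string_wtS j : (j < N)%N ->
    string_wt j.+1 = string_wt j + tail_flow (nth default_tail tail_list j).
Proof.
by move=> h; rewrite /string_wt (take_nth default_tail) // -cats1 total_flow_cat
    /total_flow big_seq1 addrA.
Qed.

Lemma ends_tail_list b :
  ends (fun i : 'I_N => left_at i) (fun i : 'I_N => forked_at i)
      (fun i : 'I_N => k_at i) string_wt b =
  ends_of_tails b tail_list ++ string_ends b s0 (s0 + total_flow tail_list).
Proof.
rewrite /ends string_wt0 string_wtN; congr (_ ++ _).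
rewrite /tail_ends /ends_of_tails; congr flatten.
rewrite -[X in _ = [seq _ | _ <- X & _]](mkseq_nth default_tail) /mkseq -val_enum_ord
    -map_comp filter_map -map_comp.
by [].
Qed.

Lemma size_ends_of_tails : (size (ends_of_tails true tail_list) + size
    (ends_of_tails false tail_list) =
  \sum_(0 <= j < N) (1 + forked_at j))%N.
Proof.
rewrite -(big_nth default_tail xpredT (fun d => 1 + tail_forked d)%N).
elim: tail_list => [|d T IH]; first by rewrite big_nil.
rewrite big_cons -IH !ends_of_tails_cons !size_cat !(fun_if size) size_nseq.
by case: (tail_left d) => /=; lia.
Qed.

End TailList.

(** The sum counts a fork and an attachment for each of the [2 * n] alternating
    tails, whose vertices are those of the blocks. *)
Lemma size_word (N f n : nat) (lft frk : nat -> bool) (s : nat -> int) (A B : seq nat) :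
  (f + 2 * n <= N)%N -> (forall x, alternating f n x -> frk x) ->
  (size (word N f n lft frk s A B) + 4 * n =
    size A + size B + \sum_(0 <= j < N) (1 + frk j))%N.
Proof.
move=> hN hf; rewrite !size_cat.
have hm : size (fixed_attachments N f n s) = count (fun j => ~~ alternating f n j)
    (iota 0 N).
  by rewrite size_filter; apply/seq.permP/updown_perm.
have h4 : (4 * n = \sum_(0 <= j < N) alternating f n j * 2)%N.
  rewrite -big_distrl /= (@big_cat_nat _ _ _ f) /=; [|by []|lia].
  rewrite (@big_cat_nat _ _ _ (f + 2 * n) f) /=; [|lia|lia].
  rewrite big_nat_cond big1 ?add0n; last by move=> j; rewrite /alternating; lia.
  rewrite [X in (_ + X)%N]big_nat_cond [X in (_ + X)%N]big1 ?addn0; last by move=> j;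
      rewrite /alternating; lia.
  rewrite (eq_big_nat _ _ (F2 := fun=> 1%N)); last by move=> j h;
      rewrite /alternating h.
  by rewrite sum_nat_const_nat muln1; lia.
rewrite hm /fixed_forks !size_filter -!sum1_count h4 /index_iota subn0.
rewrite [X in (X + _ + _)%N]big_mkcond [X in (_ + (_ + (X + _)) + _)%N]big_mkcond.
rewrite [X in (_ + (_ + (_ + (_ + X))) + _)%N]big_mkcond /=.
rewrite [in LHS]big_mkcond /=.
suff : (\sum_(i <- iota 0 N) (if [&& ~~ alternating f n i, lft i == true & frk i] then
    1 else 0) +
  \sum_(i <- iota 0 N) (if ~~ alternating f n i then 1 else 0) +
  \sum_(i <- iota 0 N) (if [&& ~~ alternating f n i, lft i == false & frk i] then 1
      else 0) +
  \sum_(j <- iota 0 N) alternating f n j * 2 = \sum_(j <- iota 0 N) (1 + frk j))%N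
      by lia.
rewrite -!big_split /=; apply: eq_bigr => j _; have := hf j.
by case: (alternating f n j) => [-> //|_]; case: (lft j); case: (frk j).
Qed.

Section Count.
Variables (R : realType) (la mu : seq nat) (T : seq tail_type) (s0 : int).
Hypothesis Tpos : all (fun d => 0 < tail_k d)%N T.
Hypothesis Tne : (0 < size T)%N.
Hypothesis s0_odd : odd `|s0|.
Variable sN : int.
Hypothesis sNE : sN = s0 + total_flow T.
Hypothesis HL : perm_eq (la ++ [:: 1; 1]%N)
    (ends_of_tails true T ++ string_ends true s0 sN).
Hypothesis HR : perm_eq (mu ++ [:: 1; 1]%N)
    (ends_of_tails false T ++ string_ends false s0 sN).

(** The number of forks with ends of weight 1 that takes the signed weight from
    [sN] to -1.  The same number on the other side takes it back after the
    alternating part. *)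
Definition adjustment : nat := if 0 < sN then `|sN|./2.+1 else `|sN|./2.
Definition unit_fork b : tail_type := (b, true, 1%N).
Definition alternation (n : nat) : seq tail_type :=
    flatten (nseq n [:: unit_fork true; unit_fork false]).

Variables (n : nat).
Hypothesis n_gt0 : (0 < n)%N.
Definition tail_list := T ++ nseq adjustment (unit_fork (sN <= 0)) ++ alternation n
    ++ nseq adjustment (unit_fork (0 < sN)).
Local Notation N := (size tail_list).
Definition alt_start := (size T + adjustment)%N.

Lemma size_alternation m : size (alternation m) = (2 * m)%N.
Proof. by elim: m => //= m IH; rewrite IH; lia. Qed.

Lemma size_tail_list : N = (alt_start + 2 * n + adjustment)%N.
Proof. by rewrite !size_cat !size_nseq size_alternation /alt_start; lia. Qed.

Lemma nth_alternation m j : (j < 2 * m)%N ->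
    nth default_tail (alternation m) j = if odd j then unit_fork false else unit_fork
    true.
Proof.
elim: m j => [|m IH] j //; case: j => [|[|j]] //= h.
by rewrite negbK; apply: IH; lia.
Qed.

Lemma total_flow_alternation m j : (j <= 2 * m)%N ->
    total_flow (take j (alternation m)) = (2 * odd j)%:Z.
Proof.
elim: m j => [|m IH] j; first by case: j => // _; rewrite /total_flow big_nil.
case: j => [|[|j]] //= h; rewrite ?take0 /total_flow ?big_cons ?big_nil //
    -/(total_flow _).
by rewrite IH /= ?negbK /tail_flow /=; lia.
Qed.

Lemma nth_tail_list_alt x : alternating alt_start n x ->
    nth default_tail tail_list x = if odd (x - alt_start) then unit_fork false else
    unit_fork true.
Proof.
rewrite /alternating /alt_start => h;
    rewrite /tail_list catA nth_cat size_cat size_nseq.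
have -> : (x < size T + adjustment)%N = false by lia.
rewrite nth_cat size_alternation; have ->
    : (x - (size T + adjustment) < 2 * n)%N by lia.
by apply: nth_alternation; lia.
Qed.

Lemma total_flow_nseq m d : total_flow (nseq m d) = tail_flow d *+ m.
Proof. by rewrite /total_flow big_nseq; elim: m => [|m IH] //=; rewrite IH mulrS. Qed.

Lemma sN_odd : odd `|sN|.
Proof. by have := perm_sumn HL; have := perm_sumn HR; rewrite sNE total_flow_ends;
 have := odd_sumn_ends_of_tails true T; have := odd_sumn_ends_of_tails false T;
     lia. Qed.

Lemma adjustment_flow : sN + tail_flow (unit_fork (sN <= 0)) *+ adjustment = -1.
Proof.
by have := sN_odd; rewrite /tail_flow /adjustment /tail_left /=; case: (ltrP 0 sN) =>
    h /=; lia.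
Qed.

Lemma string_wt_alt x : (alt_start <= x <= alt_start + 2 * n)%N ->
  string_wt tail_list s0 x = -1 + (2 * odd (x - alt_start))%:Z.
Proof.
move=> h; have e : take x tail_list = T ++ nseq adjustment (unit_fork (sN <= 0))
    ++ take (x - alt_start) (alternation n).
  rewrite /tail_list catA take_cat size_cat size_nseq -/alt_start ltnNge;
      move/andP: h => [-> h] /=.
  by rewrite takel_cat ?catA // size_alternation leq_subLR.
rewrite /string_wt e !total_flow_cat total_flow_nseq total_flow_alternation
    ?leq_subLR; last by case/andP: h.
by rewrite !addrA -sNE adjustment_flow.
Qed.

Lemma total_flow_tail_list : s0 + total_flow tail_list = sN.
Proof.
have e : total_flow (alternation n) = 0 by rewrite -[alternation n]take_size
    total_flow_alternation ?size_alternation // oddM.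
rewrite /tail_list !total_flow_cat !total_flow_nseq e add0r !addrA -sNE
    adjustment_flow /unit_fork /tail_flow /tail_left /=.
by have := sN_odd; rewrite /adjustment; case: (ltrP 0 sN) => h /=; lia.
Qed.

Lemma left_at_alt x : alternating alt_start n x ->
    left_at tail_list x = ~~ odd (x - alt_start).
Proof. by move=> h; rewrite /left_at nth_tail_list_alt //; case: (odd _). Qed.

Lemma forked_at_alt x : alternating alt_start n x -> forked_at tail_list x.
Proof. by move=> h; rewrite /forked_at nth_tail_list_alt //; case: (odd _). Qed.

Lemma k_at_alt x : alternating alt_start n x -> k_at tail_list x = 1%N.
Proof. by move=> h; rewrite /k_at nth_tail_list_alt //; case: (odd _). Qed.

Lemma string_wt_sign x : (alt_start <= x <= alt_start + 2 * n)%N ->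
    (0 < string_wt tail_list s0 x) = odd (x - alt_start).
Proof. by move=> h; rewrite string_wt_alt //; case: (odd _). Qed.

Lemma tail_list_string_data : string_data (fun i : 'I_N => left_at tail_list i)
    (fun i : 'I_N => k_at tail_list i) (string_wt tail_list s0).
Proof.
split.
- by rewrite size_tail_list; move: n_gt0; lia.
- move=> i; have /allP h : all (fun d => 0 < tail_k d)%N tail_list.
    rewrite /tail_list !all_cat Tpos !all_nseq orbT /= andbT.
    by elim: n => //= m IH.
  by apply: h; apply: mem_nth.
- by rewrite string_wt0.
- by move=> i; rewrite string_wtS.
Qed.

Lemma ends_of_tail_list b : perm_eq (ends_of_tails b tail_list)
    (ends_of_tails b T ++ nseq (2 * (n + adjustment)) 1%N).
Proof.
rewrite /tail_list !ends_of_tails_cat perm_cat2l !ends_of_tails_nseq.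
have -> : ends_of_tails b (alternation n) = nseq (2 * n) 1%N.
  elim: n => // m IH; rewrite -[alternation m.+1]/(unit_fork true :: unit_fork false
      :: alternation m).
  by rewrite !ends_of_tails_cons IH mulnS; case: b {IH}.
rewrite /unit_fork /tail_left /= [sN <= 0]leNgt.
have e : flatten (nseq adjustment (ends_of_tail (true, true, 1%N))) = nseq
    (2 * adjustment) 1%N.
  by rewrite mul2n -flatten_nseq2.
have e' : flatten (nseq adjustment (ends_of_tail (false, true, 1%N))) = nseq
    (2 * adjustment) 1%N.
  by rewrite mul2n -flatten_nseq2.
have c2 : nseq (2 * (n + adjustment)) 1%N = nseq (2 * adjustment) 1%N ++ nseq (2 * n)
    1%N :> seq nat.
  by rewrite mulnDr addnC nseqD.
case: (0 < sN) => /=; case: b; rewrite /= ?cats0 ?e ?e' c2 ?perm_refl //;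
  by rewrite perm_catC.
Qed.

(** The number of pairs of ones on each side: those in the unit forks, and the
    pair set aside to decompose the two given partitions. *)
Definition unit_pairs := (n + adjustment).+1.

Lemma perm_ends (b : bool) (nu : seq nat) :
  perm_eq (nu ++ [:: 1; 1]%N) (ends_of_tails b T ++ string_ends b s0 sN) ->
  perm_eq (ends (fun i : 'I_N => left_at tail_list i)
      (fun i : 'I_N => forked_at tail_list i)
    (fun i : 'I_N => k_at tail_list i) (string_wt tail_list s0) b)
        (nu ++ nseq (2 * unit_pairs) 1%N).
Proof.
move=> h; rewrite ends_tail_list total_flow_tail_list.
have -> : nu ++ nseq (2 * unit_pairs) 1%N = (nu ++ [:: 1; 1]%N) ++ nseq
    (2 * (n + adjustment)) 1%N.
  by rewrite -catA /unit_pairs mulnS.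
rewrite perm_sym (perm_trans (perm_cat h (perm_refl _))) // perm_sym.
rewrite (perm_trans (perm_cat (ends_of_tail_list b) (perm_refl _))) //.
by rewrite -catA -[X in perm_eq _ X]catA perm_cat2l perm_catC perm_refl.
Qed.

(** The first tail is not alternating, so [word_att_fixed] applies to it. *)
Lemma alt_start_gt0 : ~~ alternating alt_start n 0.
Proof. by rewrite /alternating /alt_start; move: Tne; case: (size T) => // m _;
    rewrite addSn. Qed.

Lemma alt_end_le : (alt_start + 2 * n <= N)%N.
Proof. by rewrite size_tail_list leq_addr. Qed.

Variables (g k : nat) (y : seq R).
Hypothesis kn : (k <= n)%N.
Hypothesis y_sorted : sorted <%R y.
Hypothesis y_size : (size y = size la + size mu + 2 * g + 4 * unit_pairs - 2)%N.

Definition tail_word A B := word N alt_start n (left_at tail_list)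
    (forked_at tail_list) (string_wt tail_list s0) A B.

Lemma size_tail_word A B : size A = (2 * n + 2 * g)%N -> size B = (2 * n)%N ->
  size (tail_word A B) = size y.
Proof.
move=> hA hB; have := size_word (left_at tail_list) (string_wt tail_list s0) A B
    alt_end_le forked_at_alt.
rewrite -/(tail_word A B) hA hB -size_ends_of_tails; move: (size (tail_word A B)) => W.
rewrite (perm_size (ends_of_tail_list true)) (perm_size (ends_of_tail_list false)).
rewrite [size (_ ++ _)]size_cat [size (ends_of_tails false T ++ _)]size_cat !size_nseq
    y_size /unit_pairs.
have eL : (size la + 2 = size (ends_of_tails true T) + size (string_ends true s0 sN))%N.
  by rewrite -[2%N]/(size [:: 1; 1]%N) -!size_cat (perm_size HL).
have eR : (size mu + 2 = size (ends_of_tails false T) + size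
    (string_ends false s0 sN))%N.
  by rewrite -[2%N]/(size [:: 1; 1]%N) -!size_cat (perm_size HR).
have : (size (string_ends true s0 sN) + size (string_ends false s0 sN) = 2)%N.
  by rewrite /string_ends; case: (0 < s0); case: (0 < sN).
move: eL eR.
move: (size (string_ends true _ _)) (size (string_ends false _ _))
    (size (ends_of_tails true _)) (size (ends_of_tails false _)).
by clear; lia.
Qed.

Definition height (q : 'I_(size y)) : R := nth 0 y q.

Lemma height_lt (q q' : 'I_(size y)) : (q < q')%N -> height q < height q'.
Proof.
by move=> h; apply: (sorted_ltn_nth lt_trans 0 y_sorted); rewrite ?inE.
Qed.

Lemma mem_height r : (r \in y) = [exists q, height q == r].
Proof.
apply/(nthP 0)/existsP => [[i hi <-]|[q /eqP <-]]; first by exists (Ordinal hi).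
by exists q.
Qed.

(** The orders of the left forks and attachments, those of the right attachments
    and forks, and the free part of the distribution of the cycle vertices. *)
Definition param : finType := (('S_n * 'S_n) * ('S_n * 'S_n) * (2 * g - k).-tuple
    'I_k)%type.

Lemma card_param : #|param| = (n`! ^ 4 * k ^ (2 * g - k))%N.
Proof.
rewrite !card_prod card_tuple card_ord !card_Sn; congr muln.
by rewrite !expnS expn0 muln1 !mulnA.
Qed.

Definition param_left (x : param) := block_left alt_start x.1.1.1 x.1.1.2 x.2.
Definition param_right (x : param) := block_right alt_start x.1.2.1 x.1.2.2.
Definition param_word (x : param) := tail_word (param_left x) (param_right x).

Lemma size_param_word x : size (param_word x) = size y.
Proof. by apply: size_tail_word;
    [exact: size_block_left | exact: size_block_right]. Qed.

Variables (i0 : 'I_N) (q0 : 'I_(size y)).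

Definition param_cover (x : param) : cover_data R :=
  zcover (fun i : 'I_N => left_at tail_list i) (fun i : 'I_N => forked_at tail_list i)
    (fun i : 'I_N => k_at tail_list i) (string_wt tail_list s0) height
    (word_lab i0 (param_word x)) (word_att i0 q0 (fun i : 'I_N => left_at tail_list i)
        (param_word x)).

Lemma good_param_left x : good_block alt_start n (left_at tail_list) true
    (param_left x).
Proof. by apply: good_block_left => //; exact: left_at_alt. Qed.
Lemma good_param_right x : good_block alt_start n (left_at tail_list) false
    (param_right x).
Proof. by apply: good_block_right => //; exact: left_at_alt. Qed.

Lemma param_layout x : layout (fun i : 'I_N => left_at tail_list i)
    (fun i : 'I_N => forked_at tail_list i)
    (fun i : 'I_N => k_at tail_list i) (string_wt tail_list s0)
    (word_lab i0 (param_word x)) (word_att i0 q0 (fun i : 'I_N => left_at tail_list i)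
        (param_word x)).
Proof.
apply: (word_layout alt_end_le left_at_alt forked_at_alt k_at_alt string_wt_sign
    (good_param_left x) (good_param_right x)).
exact: size_param_word.
Qed.

Lemma param_cover_zigzag x :
  tropical_cover g (la ++ nseq (2 * unit_pairs) 1%N) (mu ++ nseq (2 * unit_pairs) 1%N)
      y (param_cover x) /\
  zigzag (param_cover x).
Proof.
have [hN hk hs0 hs] := tail_list_string_data; have [La Ia Pa Ca Oa] := param_layout x.
split; last exact: (zcover_zigzag height La Ia Pa hs0 hs hN Ca).
apply: (zcover_tropical La Ia Pa hk hs0 hs hN Oa height_lt).
- exact: perm_ends HL.
- exact: perm_ends HR.
- exact: mem_height.
- by rewrite !size_cat !size_nseq y_size /unit_pairs; clear; lia.
Qed.

Lemma param_cover_inj x x' : cover_iso (param_cover x) (param_cover x') -> x = x'.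
Proof.
move=> hiso.
have h0 (i : 'I_N) : (i : nat) = 0%N ->
    word_att i0 q0 (fun i : 'I_N => left_at tail_list i) (param_word x) i = word_att
        i0 q0 (fun i : 'I_N => left_at tail_list i) (param_word x') i.
  move=> hi; have hf : ~~ alternating alt_start n i by rewrite hi alt_start_gt0.
  apply: val_inj => /=; rewrite (word_att_fixed alt_end_le (good_param_left x)
      (good_param_right x) i0 q0 (size_param_word x) hf).
  rewrite (word_att_fixed alt_end_le (good_param_left x') (good_param_right x') i0 q0
      (size_param_word x') hf).
  by rewrite !size_block_left.
have hlab := iso_lab height_lt tail_list_string_data (param_layout x)
    (param_layout x') hiso h0.
have lw z := word_letters (forked_at tail_list) (string_wt tail_list s0) alt_end_le
    (good_param_left z) (good_param_right z).
have : param_word x = param_word x'.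
  apply: (@eq_from_nth _ 0%N) => [|j]; rewrite !size_param_word // => hj.
  have := congr1 val (hlab (Ordinal hj)); rewrite /= !val_word_lab //;
      try exact: size_param_word; try exact: lw.
move/eqP; rewrite /param_word /tail_word /word eqseq_cat // => /andP[_].
rewrite eqseq_cat ?size_block_left // => /andP[/eqP hA].
rewrite eqseq_cat // => /andP[_]; rewrite eqseq_cat ?size_block_right // =>
    /andP[/eqP hB _].
case: x x' hA hB {hiso h0 hlab} => [[[p p'] [r r']] x] [[[q q'] [u u']] z].
move=> /= hA hB. have /= [e1 e2 e3] := block_left_inj hA. have /= [e4 e5] :=
    block_right_inj hB.
by rewrite e1 e2 e3 e4 e5.
Qed.

End Count.

Theorem zigzag_number_lower (R : realType) (la mu : seq nat) (T : seq tail_type)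
    (s0 : int) :
  all (fun d => 0 < tail_k d)%N T -> (0 < size T)%N -> odd `|s0| ->
  perm_eq (la ++ [:: 1; 1]%N) (ends_of_tails true T ++ string_ends true s0
      (s0 + total_flow T)) ->
  perm_eq (mu ++ [:: 1; 1]%N) (ends_of_tails false T ++ string_ends false s0
      (s0 + total_flow T)) ->
  forall (n g k : nat) (y : seq R), (0 < n)%N -> (k <= n)%N -> sorted <%R y ->
  let m := (n + adjustment (s0 + total_flow T)).+1 in
  (size y = size la + size mu + 2 * g + 4 * m - 2)%N ->
  (n`! ^ 4 * k ^ (2 * g - k) <=
   zigzag_number g (la ++ nseq (2 * m) 1) (mu ++ nseq (2 * m) 1) y)%N.
Proof.
move=> h1 h2 h3 h4 h5 n g k y n0 kn ys m hsz.
have [N1 _ _ _] := tail_list_string_data h1 h2 h3 erefl h4 h5 n0.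
have y0 : (0 < size y)%N by rewrite hsz /m; clear; lia.
rewrite -(card_param n g k).
apply: (zigzag_number_ge (f := param_cover s0 (Ordinal (ltnW N1)) (Ordinal y0))) =>
    [x|x x'].
  exact: (param_cover_zigzag h1 h2 h3 erefl h4 h5 n0 kn ys hsz).
exact: (param_cover_inj h1 h2 h3 erefl h4 h5 n0 kn ys hsz).
Qed.

(** * Asymptotics *)

Lemma fact_ge_exp (n k : nat) : (k <= n)%N -> (k ^ (n - k) <= n`!)%N.
Proof.
elim: n => [|n IH]; first by case: k.
rewrite leq_eqVlt => /orP[/eqP ->|]; first by rewrite subnn expn0 fact_gt0.
rewrite ltnS => h; rewrite subSn // expnS factS leq_mul // ?IH //.
by rewrite ltnW.
Qed.

Lemma nat_above (R : realType) (x : R) : exists N : nat, forall m, (N <= m)%N ->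
    x <= m%:R.
Proof.
exists (Num.bound x) => m hm; apply: le_trans (ler_norm x) _.
apply: le_trans (ltW (archi_boundP (normr_ge0 x))) _.
by rewrite ler_nat (leq_trans _ hm) // /Num.bound normr_id.
Qed.

Lemma coarse_quotient (D m : nat) : (1 < D)%N -> (D <= m)%N -> exists k : nat,
  [/\ (0 < k)%N, (k * D <= m)%N & (m <= k * (2 * D))%N].
Proof.
move=> D1 Dm; have D0 := ltnW D1; have k0 : (0 < m %/ D)%N by rewrite divn_gt0.
exists (m %/ D)%N; split=> //; first exact: leq_divM.
apply: ltnW (leq_trans (ltn_ceil m D0) _).
by rewrite mulnA leq_mul2r -addn1 muln2 -addnn leq_add2l k0 orbT.
Qed.

(** For [k] about [m / D] one has [ln k >= ln m - ln (2 D)], and the exponent of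
    [k] is at least [4 m + 2 g - 4 C - 5 k].  Both are within a factor [1 - e] of
    their limits as soon as [D >= 5 / (2 e)] and [m] is large. *)
Lemma log_asymptotics (R : realType) (C : nat) (z : nat -> nat -> nat) :
  (forall g m k, (C < m)%N -> (k <= m - C)%N ->
     ((m - C)`! ^ 4 * k ^ (2 * g - k) <= z g m)%N) ->
  joint_liminf_ge
    (fun g m => ln (z g m)%:R / (2 * g%:R * ln m%:R + 4 * m%:R * ln m%:R) : R) 1.
Proof.
move=> hz eps eps0.
have [e [e0 e1 ee]] : exists e : R, [/\ 0 < e, e <= 1 / 2 & 2 * e <= eps].
  exists (Num.min eps 1 / 2); split.
  - by rewrite divr_gt0 // lt_min eps0 ltr01.
  - by rewrite ler_pM2r ?invr_gt0 // ge_min lexx orbT.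
  - by rewrite mulrC divfK // ge_min lexx.
have [D [hD D2]] : exists D : nat, 5 / (2 * e) <= D%:R /\ (1 < D)%N.
  have [D hD] := nat_above (5 / (2 * e)).
  by exists D.+2; split=> //; apply: hD; rewrite -addn2 leq_addr.
have [N1 h1] := nat_above (2 * C%:R / e).
have [N2 h2] := nat_above (expR (ln (2 * D)%:R / e)).
(* [D], [2 * C] and 2 ensure [1 <= k <= m - C] and [0 < ln m]; [N1] makes [4 * C] and
   [N2] makes [ln (2 * D)] negligible *)
exists (D + 2 * C + 2 + N1 + N2)%N => g m _ hm.
have {h1} ham : 2 * C%:R / e <= m%:R by apply: h1; clear -hm; lia.
have {h2} hbm : expR (ln (2 * D)%:R / e) <= m%:R by apply: h2; clear -hm; lia.
have mD : (D <= m)%N by clear -hm; lia.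
have mC : (2 * C <= m)%N by clear -hm; lia.
have m2 : (1 < m)%N by clear -hm; lia.
have [k [k0 kD mk]] := coarse_quotient D2 mD.
have kn : (k <= m - C)%N.
  have : (2 * k <= m)%N by apply: leq_trans kD; rewrite mulnC leq_mul2l D2 orbT.
  by clear -mC; lia.
have Cm : (C < m)%N by clear -mC m2; lia.
have m0n : (0 < m)%N by exact: ltnW.
have m0 : (0 : R) < m%:R by rewrite ltr0n.
have lm : 0 < ln m%:R :> R by rewrite ln_gt0 // ltr1n.
have k_at : (1 - e) * ln m%:R <= ln k%:R :> R.
  have h1 : ln m%:R <= ln k%:R + ln (2 * D)%:R :> R.
    rewrite -lnM ?posrE ?ltr0n ?muln_gt0 ?(ltnW D2) //.
    by rewrite -natrM ler_ln ?posrE ?ltr0n ?muln_gt0 ?k0 ?m0n ?(ltnW D2) // ler_nat.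
  have h2 : ln (2 * D)%:R <= e * ln m%:R :> R.
    by rewrite mulrC -ler_pdivrMr // -[X in X <= _]expRK ler_ln ?posrE ?expR_gt0.
  by lra.
have lz : (4 * m%:R + 2 * g%:R - 4 * C%:R - 5 * k%:R) * ln k%:R <= ln (z g m)%:R :> R.
  have hk : (k ^ (4 * (m - C - k) + (2 * g - k)) <= z g m)%N.
    apply: leq_trans (hz g m k Cm kn); rewrite expnD leq_mul // (mulnC 4) expnM.
    by rewrite leq_exp2r // fact_ge_exp.
  have lk0 : 0 <= ln k%:R :> R by rewrite ln_ge0 // ler1n.
  have exponent : (4 * m + 2 * g <=
      (4 * (m - C - k) + (2 * g - k)) + (4 * C + 5 * k))%N by clear; lia.
  apply: (@le_trans _ _ ((4 * (m - C - k) + (2 * g - k))%:R * ln k%:R)).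
    apply: ler_wpM2r => //; move: exponent; move: (4 * (_ - k) + _)%N => E.
    have -> : (4 * m + 2 * g <= E + (4 * C + 5 * k))%N =
        (4 * m%:R + 2 * g%:R <= E%:R + (4 * C%:R + 5 * k%:R) :> R).
      by rewrite -!natrM -!natrD ler_nat.
    by clear; lra.
  rewrite mulr_natl -lnXn ?ltr0n // -natrX ler_ln ?posrE ?ltr0n ?expn_gt0 ?k0 //.
    by rewrite ler_nat.
  by apply: leq_trans hk; rewrite expn_gt0 k0.
have den : 0 < 2 * g%:R * ln m%:R + 4 * m%:R * ln m%:R :> R.
  by rewrite ltr_wpDl // ?mulr_ge0 ?mulr_gt0 // ltW.
rewrite ler_pdivlMr //; apply: le_trans lz.
have g0 : 0 <= g%:R :> R by [].
have kR : k%:R * D%:R <= m%:R :> R by rewrite -natrM ler_nat.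
have k5 : 5 * k%:R <= 2 * e * m%:R.
  have h5 : 5 <= D%:R * (2 * e) by rewrite -ler_pdivrMr // mulr_gt0.
  have kk0 : (0 : R) <= k%:R by [].
  by clear -h5 kk0 kR e0; nra.
have C4 : 4 * C%:R <= 2 * e * m%:R.
  by move: ham; rewrite ler_pdivrMr //; clear; lra.
have ff0 : 0 <= 1 - e by clear -e1; lra.
apply: (@le_trans _ _ ((1 - e) * (4 * m%:R + 2 * g%:R) * ((1 - e) * ln m%:R))).
  rewrite [X in _ <= X](_ : _ = (1 - e) ^+ 2 * ((2 * g%:R + 4 * m%:R) * ln m%:R));
      last by ring.
  rewrite -mulrDl ler_wpM2r //; first by rewrite mulr_ge0 ?ltW // ltr_wpDl ?mulr_ge0
      ?mulr_gt0.
  by clear -ee; nra.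
apply: ler_pM => //; first by rewrite mulr_ge0 // addr_ge0 ?mulr_ge0 // ltW.
  by rewrite mulr_ge0 // ltW.
by clear -k5 C4 g0 e0; nra.
Qed.

Theorem theorem1p4 (R : realType) (la mu : seq nat)
    (hla : is_partition la) (hmu : is_partition mu)
    (hsum : sumn la = sumn mu)
    (hodd : (odd_mult_odds la + odd_mult_odds mu <= 2)%N)
    (y : nat -> nat -> seq R)
    (hy : forall g m, sorted <%R (y g m))
    (ht : forall g m,
        size (y g m) = (size la + size mu + 2 * g + 4 * m - 2)%N) :
  let z g m :=
    zigzag_number g (la ++ nseq (2 * m) 1%N) (mu ++ nseq (2 * m) 1%N) (y g m) in
  joint_liminf_ge
    (fun g m => ln (z g m)%:R / (2 * g%:R * ln m%:R + 4 * m%:R * ln m%:R) : R) 1.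
Proof.
have [T [s0 [h1 h2 h3 h4 h5]]] := decompose hla hmu hsum hodd.
move=> z; apply: (@log_asymptotics R (adjustment (s0 + total_flow T)).+1) =>
    g m k hm hk.
have em : (m - (adjustment (s0 + total_flow T)).+1 + adjustment
    (s0 + total_flow T)).+1 = m by lia.
have := zigzag_number_lower h1 h2 h3 h4 h5
    (n := (m - (adjustment (s0 + total_flow T)).+1)%N) (g := g) (k := k) (y := y g m).
have n0 : (0 < m - (adjustment (s0 + total_flow T)).+1)%N by rewrite subn_gt0.
by move=> /(_ n0 hk (hy g m)); cbv zeta; rewrite em => /(_ (ht g m)).
Qed.
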